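(* Let $X$ and $Y$ be locally realcompact spaces, neither of which is realcompact. If $(\mathscr{R}(X),\leq)$ and $(\mathscr{R}(Y),\leq)$ are order-isomorphic, then $\mathrm{cl}_{\beta X}(\upsilon X\setminus X)$ and $\mathrm{cl}_{\beta Y}(\upsilon Y\setminus Y)$ are homeomorphic.
   Context: All spaces are completely regular Hausdorff. $\beta X$ is the Stone–Čech compactification and $\upsilon X\subseteq\beta X$ the Hewitt realcompactification of $X$. An extension of $X$ is a space containing $X$ as a dense subspace; its remainder is $Y\setminus X$. Extensions are identified up to homeomorphisms fixing $X$ pointwise, and $Y\leq Y'$ means there is a continuous map $Y'\to Y$ fixing $X$ pointwise. A space is realcompact if it is homeomorphic to a closed subspace of a power of $\mathbb{R}$; $X$ is locally realcompact if every point has an open neighborhood with realcompact closure. $\mathscr{R}(X)$ denotes the set of all realcompact extensions of $X$ with compact remainder, partially ordered by $\leq$. *)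

(* Defs.v *)
From Stdlib Require Import Reals Lra List.
Open Scope R_scope.

Record Space := mkSpace {
  pt :> Type;
  is_open : (pt -> Prop) -> Prop;
  open_full : is_open (fun _ => True);
  open_inter : forall U V, is_open U -> is_open V -> is_open (fun x => U x /\ V x);
  open_union : forall F : (pt -> Prop) -> Prop,
      (forall U, F U -> is_open U) -> is_open (fun x => exists U, F U /\ U x)
}.
Arguments is_open {s} _.

Definition is_closed {X : Space} (C : X -> Prop) : Prop :=
  is_open (fun x => ~ C x).

Definition closure {X : Space} (S : X -> Prop) : X -> Prop :=
  fun x => forall U, is_open U -> U x -> exists y, U y /\ S y.

Definition continuous {X Y : Space} (f : X -> Y) : Prop :=
  forall V : Y -> Prop, is_open V -> is_open (fun x => V (f x)).

Definition sub_open {X : Space} (S : X -> Prop) (V : {x : X | S x} -> Prop) : Prop :=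
  exists U : X -> Prop, is_open U /\ forall z, V z <-> U (proj1_sig z).

Lemma sub_open_full {X : Space} (S : X -> Prop) : sub_open S (fun _ => True).
Proof. exists (fun _ => True); split; [apply open_full | tauto]. Qed.

Lemma sub_open_inter {X : Space} (S : X -> Prop) U V :
  sub_open S U -> sub_open S V -> sub_open S (fun x => U x /\ V x).
Proof.
  intros [U' [HU EU]] [V' [HV EV]]. exists (fun x => U' x /\ V' x).
  split; [apply open_inter; auto|]. intro z. rewrite EU, EV. tauto.
Qed.

Lemma sub_open_union {X : Space} (S : X -> Prop) (F : ({x : X | S x} -> Prop) -> Prop) :
  (forall U, F U -> sub_open S U) -> sub_open S (fun x => exists U, F U /\ U x).
Proof.
  intros H.
  exists (fun x => exists W, (is_open W /\ exists U, F U /\ forall z, U z <-> W (proj1_sig z)) /\ W x).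
  split.
  - apply open_union. intros W [HW _]; exact HW.
  - intro z; split.
    + intros [U [FU Uz]]. destruct (H U FU) as [W [HW EW]].
      exists W. split; [split; [exact HW | exists U; split; assumption] | apply EW; exact Uz].
    + intros [W [[HW [U [FU EU]]] Wz]]. exists U. split; [exact FU | apply EU; exact Wz].
Qed.

Definition subspace {X : Space} (S : X -> Prop) : Space :=
  mkSpace {x : X | S x} (sub_open S) (sub_open_full S) (sub_open_inter S) (sub_open_union S).

Definition homeomorphic (X Y : Space) : Prop :=
  exists (f : X -> Y) (g : Y -> X),
    continuous f /\ continuous g /\ (forall x, g (f x) = x) /\ (forall y, f (g y) = y).

Definition embedding {X Y : Space} (e : X -> Y) : Prop :=
  (forall x x', e x = e x' -> x = x') /\ continuous e /\
  (forall U : X -> Prop, is_open U ->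
     exists V : Y -> Prop, is_open V /\ forall x, U x <-> V (e x)).

Definition image {X Y : Type} (e : X -> Y) : Y -> Prop := fun y => exists x, y = e x.

Definition dense {Y : Space} (S : Y -> Prop) : Prop :=
  forall U : Y -> Prop, is_open U -> (exists y, U y) -> exists y, U y /\ S y.

Definition hausdorff (X : Space) : Prop :=
  forall x y : X, x <> y -> exists U V, is_open U /\ is_open V /\ U x /\ V y /\
     (forall z, U z -> V z -> False).

Definition compact (X : Space) : Prop :=
  forall F : (X -> Prop) -> Prop, (forall U, F U -> is_open U) ->
    (forall x, exists U, F U /\ U x) ->
    exists l : list (X -> Prop), (forall U, In U l -> F U) /\
       (forall x, exists U, In U l /\ U x).

Definition R_open (U : R -> Prop) : Prop :=
  forall x, U x -> exists eps, eps > 0 /\ forall y, Rabs (y - x) < eps -> U y.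

Lemma R_open_full : R_open (fun _ => True).
Proof. intros x _; exists 1; split; [lra | auto]. Qed.

Lemma R_open_inter U V : R_open U -> R_open V -> R_open (fun x => U x /\ V x).
Proof.
  intros HU HV x [Ux Vx]. destruct (HU x Ux) as [e1 [He1 H1]].
  destruct (HV x Vx) as [e2 [He2 H2]]. exists (Rmin e1 e2). split.
  - apply Rmin_glb_lt; assumption.
  - intros y Hy. split; [apply H1 | apply H2];
      eapply Rlt_le_trans; eauto; [apply Rmin_l | apply Rmin_r].
Qed.

Lemma R_open_union (F : (R -> Prop) -> Prop) :
  (forall U, F U -> R_open U) -> R_open (fun x => exists U, F U /\ U x).
Proof.
  intros H x [U [FU Ux]]. destruct (H U FU x Ux) as [e [He HE]].
  exists e. split; [exact He|]. intros y Hy. exists U. split; auto.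
Qed.

Definition RSpace : Space := mkSpace R R_open R_open_full R_open_inter R_open_union.

Definition prod_open (I : Type) (W : (I -> R) -> Prop) : Prop :=
  forall f, W f -> exists l : list (I * (R -> Prop)),
    (forall p, In p l -> R_open (snd p) /\ snd p (f (fst p))) /\
    (forall g, (forall p, In p l -> snd p (g (fst p))) -> W g).

Lemma prod_open_full I : prod_open I (fun _ => True).
Proof. intros f _. exists nil. split; [intros p [] | auto]. Qed.

Lemma prod_open_inter I U V : prod_open I U -> prod_open I V ->
  prod_open I (fun x => U x /\ V x).
Proof.
  intros HU HV f [Uf Vf]. destruct (HU f Uf) as [l1 [A1 B1]].
  destruct (HV f Vf) as [l2 [A2 B2]]. exists (l1 ++ l2). split.
  - intros p Hp. apply in_app_or in Hp. destruct Hp; auto.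
  - intros g Hg. split; [apply B1 | apply B2]; intros p Hp; apply Hg;
      apply in_or_app; auto.
Qed.

Lemma prod_open_union I (F : ((I -> R) -> Prop) -> Prop) :
  (forall U, F U -> prod_open I U) -> prod_open I (fun x => exists U, F U /\ U x).
Proof.
  intros H f [U [FU Uf]]. destruct (H U FU f Uf) as [l [A B]].
  exists l. split; [exact A|]. intros g Hg. exists U. split; auto.
Qed.

Definition Rpower (I : Type) : Space :=
  mkSpace (I -> R) (prod_open I) (prod_open_full I) (prod_open_inter I) (prod_open_union I).

Definition completely_regular (X : Space) : Prop :=
  forall (C : X -> Prop) (x : X), is_closed C -> ~ C x ->
    exists f : X -> RSpace, continuous f /\ f x = 0 /\ forall y, C y -> f y = 1.

Definition tychonoff (X : Space) : Prop := completely_regular X /\ hausdorff X.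

Definition realcompact (X : Space) : Prop :=
  exists (I : Type) (e : X -> Rpower I), embedding e /\ is_closed (image e).

Definition locally_realcompact (X : Space) : Prop :=
  forall x : X, exists U : X -> Prop, is_open U /\ U x /\ realcompact (subspace (closure U)).

Record Ext (X : Space) := mkExt {
  ext_space : Space;
  ext_emb : X -> ext_space;
  ext_tych : tychonoff ext_space;
  ext_embedding : embedding ext_emb;
  ext_dense : dense (image ext_emb)
}.
Arguments ext_space {X} _.
Arguments ext_emb {X} _.

Definition remainder {X : Space} (A : Ext X) : Space :=
  subspace (fun y : ext_space A => ~ image (ext_emb A) y).

Definition in_RX {X : Space} (A : Ext X) : Prop :=
  realcompact (ext_space A) /\ compact (remainder A).

Definition ext_le {X : Space} (A B : Ext X) : Prop :=
  exists f : ext_space B -> ext_space A, continuous f /\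
    forall x, f (ext_emb B x) = ext_emb A x.

Definition ext_equiv {X : Space} (A B : Ext X) : Prop :=
  exists (f : ext_space A -> ext_space B) (g : ext_space B -> ext_space A),
    continuous f /\ continuous g /\ (forall a, g (f a) = a) /\ (forall b, f (g b) = b) /\
    (forall x, f (ext_emb A x) = ext_emb B x).

(* (R(X), <=) and (R(Y), <=) are order-isomorphic: an order isomorphism between
   the sets of equivalence classes, presented by a representative-level map. *)
Definition RX_order_isomorphic (X Y : Space) : Prop :=
  exists Phi : Ext X -> Ext Y,
    (forall A, in_RX A -> in_RX (Phi A)) /\
    (forall A A', in_RX A -> in_RX A' -> ext_equiv A A' -> ext_equiv (Phi A) (Phi A')) /\
    (forall A A', in_RX A -> in_RX A' -> ext_equiv (Phi A) (Phi A') -> ext_equiv A A') /\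
    (forall B, in_RX B -> exists A, in_RX A /\ ext_equiv (Phi A) B) /\
    (forall A A', in_RX A -> in_RX A' -> (ext_le A A' <-> ext_le (Phi A) (Phi A'))).

Definition stone_cech (X : Space) (bX : Space) (e : X -> bX) : Prop :=
  compact bX /\ hausdorff bX /\ embedding e /\ dense (image e) /\
  forall f : X -> RSpace, continuous f -> (exists M, forall x, Rabs (f x) <= M) ->
    exists g : bX -> RSpace, continuous g /\ forall x, g (e x) = f x.

Definition hewitt {X bX : Space} (e : X -> bX) : bX -> Prop :=
  fun p => forall f : X -> RSpace, continuous f ->
    exists g : subspace (fun q : bX => image e q \/ q = p) -> RSpace,
      continuous g /\
      forall x (h : image e (e x) \/ e x = p), g (exist _ (e x) h) = f x.

Definition cl_hewitt_remainder {X bX : Space} (e : X -> bX) : bX -> Prop :=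
  closure (fun p => hewitt e p /\ ~ image e p).

(* Main.v *)
(** The extensions in R(X) are the quotients of the spaces [X u C], where [C] is compact,
    [K := cl(vX \ X) <= C <= bX \ X], by closed equivalence relations on [C].  Each extension is
    thus encoded by a partial equivalence relation on [bX \ X] (two points are related when [X]
    converges to the same point of the extension along both), and the order of R(X) becomes
    reverse inclusion of these relations.  The minimal nontrivial relations are of two kinds:
    two points of [K] are identified, or a point [p] outside [K] is added to [K].  Only in the
    second kind is there a strictly larger relation above no further minimal one (glue [p] to a
    point of [K]), so the order determines the two-point subsets of [K].  As in Magill's
    theorem, looking at triangles of pairs recovers the points of [K], and the relations with a
    single nontrivial class recover its closed sets. *)
From Stdlib Require Import Reals Lra Lia List Classical ClassicalEpsilon.
From Stdlib Require Import FunctionalExtensionality PropExtensionality.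
Require Import Defs.

(** * Compact Hausdorff spaces and Urysohn's lemma *)

(** No quotient space is formed. An extension enters only through limits of [X] along points of
    [bX]. The extension realising a relation is the image of X, K and a closed set F in a power of
    R, under all functions continuous there and constant on F. Unbounded functions must be allowed:
    realcompactness asks for a closed image, and a point of [bX] outside X, K and F is not in the
    Hewitt realcompactification, so one of these functions blows up at it. Only relations that add a
    single class to the diagonal of K are built; the order argument asks for no others. Local
    realcompactness keeps K off [X], so that remainders can contain it. Non-realcompactness makes K
    non-empty, so that an outside point can be glued to something. In the triangle argument the
    obstacle is that three pairwise intersecting pairs may form a star; transitivity of the
    relations excludes it. The argument needs three points, so K with one or two points is treated
    apart. *)

Lemma open_ext {X : Space} (U V : X -> Prop) :
  is_open U -> (forall x, U x <-> V x) -> is_open V.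
Proof.
  intros HU E. replace V with U; [exact HU|].
  apply functional_extensionality; intro x. apply propositional_extensionality, E.
Qed.

Lemma open_local {X : Space} (U : X -> Prop) :
  (forall x, U x -> exists V, is_open V /\ V x /\ forall y, V y -> U y) -> is_open U.
Proof.
  intros H.
  apply (open_ext (fun x => exists V, (is_open V /\ forall y, V y -> U y) /\ V x)).
  - apply open_union. intros V [HV _]; exact HV.
  - intro x; split.
    + intros [V [[_ HV] Vx]]; auto.
    + intros Ux. destruct (H x Ux) as [V [HV [Vx S]]]. exists V; auto.
Qed.

Lemma open_or {X : Space} (U V : X -> Prop) :
  is_open U -> is_open V -> is_open (fun x => U x \/ V x).
Proof.
  intros HU HV; apply open_local; intros x [H|H]; [exists U | exists V]; auto.
Qed.

Lemma closed_or {X : Space} (A B : X -> Prop) :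
  is_closed A -> is_closed B -> is_closed (fun x => A x \/ B x).
Proof.
  intros HA HB. eapply open_ext; [exact (open_inter _ _ _ HA HB)|].
  intro x; cbn; tauto.
Qed.

Lemma closed_compl {X : Space} (U : X -> Prop) : is_open U -> is_closed (fun x => ~ U x).
Proof. intros HU. eapply open_ext; [exact HU|]. intro x; split; [tauto | apply NNPP]. Qed.

Lemma closed_empty {X : Space} : is_closed (fun _ : X => False).
Proof. eapply open_ext; [apply open_full|]. intro x; tauto. Qed.

Lemma closed_point {X : Space} (a : X) : hausdorff X -> is_closed (fun x => x = a).
Proof.
  intros H. apply open_local. intros x Hx.
  destruct (H x a Hx) as [U [V [HU [HV [Ux [Va D]]]]]].
  exists U; repeat split; auto. intros y Uy ->. eauto.
Qed.

Lemma closure_incl {X : Space} (S : X -> Prop) x : S x -> closure S x.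
Proof. intros Sx U _ Ux; eauto. Qed.

Lemma closure_sub_closed {X : Space} (S C : X -> Prop) :
  is_closed C -> (forall x, S x -> C x) -> forall x, closure S x -> C x.
Proof.
  intros HC SC x Hx. apply NNPP; intro N.
  destruct (Hx _ HC N) as [y [Ny Sy]]. auto.
Qed.

Lemma not_closure {X : Space} (S : X -> Prop) x :
  ~ closure S x -> exists U, is_open U /\ U x /\ forall y, U y -> ~ S y.
Proof.
  intros N. apply NNPP; intro M. apply N. intros U HU Ux. apply NNPP; intro Q.
  apply M; exists U; repeat split; auto. intros y Uy Sy; eauto.
Qed.

Lemma closed_closure {X : Space} (S : X -> Prop) : is_closed (closure S).
Proof.
  apply open_local. intros x Hx. destruct (not_closure _ _ Hx) as [U [HU [Ux D]]].
  exists U; repeat split; auto. intros y Uy Cy.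
  destruct (Cy U HU Uy) as [z [Uz Sz]]. exact (D z Uz Sz).
Qed.

Lemma closed_of_closure {X : Space} (C : X -> Prop) :
  (forall x, closure C x -> C x) -> is_closed C.
Proof.
  intros H. eapply open_ext; [apply (closed_closure C)|].
  intro x; split; intros N M; apply N; auto using closure_incl.
Qed.

(** Without a cluster point, finitely many open sets, each missing some [P i], would cover [X]; by
    directedness a single non-empty [P k] would miss them all. *)
Lemma cluster {X : Space} (I : Type) (ok : I -> Prop) (P : I -> X -> Prop) :
  compact X ->
  (exists i, ok i) ->
  (forall i j, ok i -> ok j -> exists k, ok k /\ forall x, P k x -> P i x /\ P j x) ->
  (forall i, ok i -> exists x, P i x) ->
  exists x, forall i, ok i -> closure (P i) x.
Proof.
  intros HX [i0 H0] Hdir Hne. apply NNPP; intro N.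
  destruct (HX (fun U => is_open U /\ exists i, ok i /\ forall x, U x -> ~ P i x))
    as [l [Hl Hc]].
  - tauto.
  - intro x. apply NNPP; intro M. apply N; exists x. intros i Hi. apply NNPP; intro Q.
    destruct (not_closure _ _ Q) as [U [HU [Ux D]]]. apply M; exists U; eauto.
  - assert (H : exists i, ok i /\ forall U, In U l -> forall x, U x -> ~ P i x).
    { clear Hc. induction l as [|U l IH].
      - exists i0; split; [auto | intros U []].
      - destruct IH as [i [Hi Di]]; [intros; apply Hl; right; auto|].
        destruct (Hl U (or_introl eq_refl)) as [_ [j [Hj Dj]]].
        destruct (Hdir i j Hi Hj) as [k [Hk Sk]]. exists k; split; auto.
        intros V [<-|HV] x Vx Px; destruct (Sk x Px); [eapply Dj | eapply Di]; eauto. }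
    destruct H as [i [Hi Di]]. destruct (Hne i Hi) as [x Px].
    destruct (Hc x) as [U [HU Ux]]. exact (Di U HU x Ux Px).
Qed.

(** Replaces the choice of a net indexed by the neighbourhoods of [t] and the passage to a
    convergent subnet. *)
Lemma cluster_nbhd {T X : Space} (t : T) (Q : (T -> Prop) -> X -> Prop) :
  compact X ->
  (forall V V' x, (forall s, V s -> V' s) -> Q V x -> Q V' x) ->
  (forall V, is_open V -> V t -> exists x, Q V x) ->
  exists x, forall V, is_open V -> V t -> closure (Q V) x.
Proof.
  intros HX Hm Hne.
  destruct (cluster _ (fun V : T -> Prop => is_open V /\ V t) Q HX) as [x Hx].
  - exists (fun _ => True); split; [apply open_full | auto].
  - intros V W [HV Vt] [HW Wt]. exists (fun s => V s /\ W s). split.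
    + split; [apply open_inter; auto | auto].
    + intros x Hx; split; eapply Hm; try exact Hx; cbn; tauto.
  - intros V [HV Vt]; auto.
  - exists x; auto.
Qed.

(* If no [U] worked, the closures of the open [U] containing [S] would cluster at a
   point of [B]. *)
Lemma separate_compact {X : Space} (S B : X -> Prop) :
  compact X -> is_closed B ->
  (forall b, B b -> exists U V, is_open U /\ is_open V /\ (forall x, S x -> U x) /\ V b /\
                          forall x, U x -> V x -> False) ->
  exists U V, is_open U /\ is_open V /\ (forall x, S x -> U x) /\ (forall x, B x -> V x) /\
         forall x, U x -> V x -> False.
Proof.
  intros HX HB H. apply NNPP; intro N.
  destruct (cluster _ (fun U : X -> Prop => is_open U /\ forall x, S x -> U x)
              (fun U x => B x /\ closure U x) HX) as [b Hb].
  - exists (fun _ => True); split; [apply open_full | auto].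
  - intros U V [HU SU] [HV SV]. exists (fun x => U x /\ V x). split.
    + split; [apply open_inter; auto | auto].
    + intros x [Bx Cx].
      split; (split; [exact Bx|]); intros W HW Wx; destruct (Cx W HW Wx) as [y [? [? ?]]]; eauto.
  - intros U [HU SU]. apply NNPP; intro M. apply N.
    exists U, (fun x => ~ closure U x). repeat split; auto.
    + apply closed_closure.
    + intros x Bx Cx; apply M; eauto.
    + intros x Ux Nx; apply Nx, closure_incl, Ux.
  - assert (Bb : B b).
    { apply (closure_sub_closed (fun x => B x /\ closure (fun _ => True) x) B HB); [tauto|].
      apply Hb. split; [apply open_full | auto]. }
    destruct (H b Bb) as [U [V [HU [HV [SU [Vb D]]]]]].
    destruct (Hb U (conj HU SU) V HV Vb) as [x [Vx [_ Cx]]].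
    destruct (Cx V HV Vx) as [y [Vy Uy]]. eauto.
Qed.

Lemma compact_hausdorff_normal {X : Space} (A B : X -> Prop) :
  compact X -> hausdorff X -> is_closed A -> is_closed B -> (forall x, A x -> B x -> False) ->
  exists U V, is_open U /\ is_open V /\ (forall x, A x -> U x) /\ (forall x, B x -> V x) /\
         forall x, U x -> V x -> False.
Proof.
  intros HX H2 HA HB D. apply separate_compact; auto.
  intros b Bb.
  destruct (separate_compact (fun x => x = b) A HX HA) as [U [V [HU [HV [SU [AV E]]]]]].
  - intros a Aa. destruct (H2 b a) as [U [V [HU [HV [Ub [Va E]]]]]].
    + intros ->; eauto.
    + exists U, V; repeat split; auto. intros x ->; auto.
  - exists V, U; repeat split; eauto.
Qed.

Section Urysohn.
Context (X : Space) (HX : compact X) (H2 : hausdorff X).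

Definition way_below (P Q : X -> Prop) : Prop := forall x, closure P x -> Q x.

Lemma way_below_incl P Q x : way_below P Q -> P x -> Q x.
Proof. intros H Px; apply H, closure_incl, Px. Qed.

Lemma interpolate P Q : is_open Q -> way_below P Q ->
  exists M, is_open M /\ way_below P M /\ way_below M Q.
Proof.
  intros HQ H.
  destruct (compact_hausdorff_normal (closure P) (fun x => ~ Q x) HX H2)
    as [U [V [HU [HV [PU [QV D]]]]]].
  - apply closed_closure.
  - apply closed_compl, HQ.
  - intros x Px Nx; exact (Nx (H x Px)).
  - exists U; repeat split; auto. intros x Cx. apply NNPP; intro N.
    destruct (Cx V HV (QV x N)) as [y [Vy Uy]]; eauto.
Qed.

(** Chosen by [epsilon] so that [dyad] can be a plain fixpoint; the value is meaningful only where
    [interpolate] applies, which [dyad_spec] establishes level by level. *)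
Definition midset (P Q : X -> Prop) : X -> Prop :=
  epsilon (inhabits P) (fun M => is_open M /\ way_below P M /\ way_below M Q).

(* [dyad P0 Q0 n k] is the open set attached to the dyadic rational [k / 2^n]; beyond the
   value 1 it is the whole space. *)
Fixpoint dyad (P0 Q0 : X -> Prop) (n k : nat) : X -> Prop :=
  match n with
  | O => match k with O => P0 | S O => Q0 | _ => fun _ => True end
  | S n => if Nat.even k then dyad P0 Q0 n (Nat.div2 k)
           else midset (dyad P0 Q0 n (Nat.div2 k)) (dyad P0 Q0 n (S (Nat.div2 k)))
  end.

Context (P0 Q0 : X -> Prop) (HP : is_open P0) (HQ : is_open Q0) (HPQ : way_below P0 Q0).
Let u := dyad P0 Q0.

Lemma even_or_odd_double k : (exists j, k = 2 * j \/ k = S (2 * j))%nat.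
Proof. destruct (Nat.Even_or_Odd k) as [[j E]|[j E]]; exists j; lia. Qed.

Lemma dyad_double n k : u (S n) (2 * k) = u n k.
Proof.
  unfold u; cbn [dyad]. rewrite Nat.even_mul, Nat.div2_double. reflexivity.
Qed.

Lemma dyad_odd n k : u (S n) (S (2 * k)) = midset (u n k) (u n (S k)).
Proof.
  unfold u; cbn [dyad]. rewrite Nat.even_succ, Nat.odd_mul, Nat.div2_succ_double. reflexivity.
Qed.

Lemma dyad_spec n : forall k, is_open (u n k) /\ way_below (u n k) (u n (S k)).
Proof.
  induction n as [|n IH]; intro k.
  - destruct k as [|[|k]]; cbn; split; auto using open_full; intros x _; exact I.
  - destruct (even_or_odd_double k) as [j Hj].
    destruct (IH j) as [Oj Wj]. destruct (IH (S j)) as [OSj _].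
    assert (M : is_open (midset (u n j) (u n (S j))) /\
                way_below (u n j) (midset (u n j) (u n (S j))) /\
                way_below (midset (u n j) (u n (S j))) (u n (S j))).
    { unfold midset. apply epsilon_spec. apply interpolate; auto. }
    destruct Hj as [->| ->].
    + rewrite dyad_double, dyad_odd. tauto.
    + rewrite dyad_odd. replace (S (S (2 * j))) with (2 * S j)%nat by lia.
      rewrite dyad_double. tauto.
Qed.

Lemma dyad_mono n j k x : (j <= k)%nat -> u n j x -> u n k x.
Proof.
  induction 1; auto. intros H'. apply (way_below_incl (u n m)); auto. apply dyad_spec.
Qed.

Lemma dyad_refine n m k : u (m + n) (2 ^ m * k) = u n k.
Proof.
  induction m as [|m IH].
  - rewrite Nat.pow_0_r, Nat.mul_1_l. reflexivity.
  - replace (2 ^ S m * k)%nat with (2 * (2 ^ m * k))%nat by (cbn; lia).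
    cbn [Nat.add]. rewrite dyad_double. exact IH.
Qed.

(** Over the common denominator [2 ^ (m + n)] this is the contrapositive of monotonicity. *)
Lemma dyad_le n k m j x : u n k x -> ~ u m j x -> INR j / 2 ^ m <= INR k / 2 ^ n.
Proof.
  intros H N.
  assert (L : (2 ^ n * j < 2 ^ m * k)%nat).
  { apply Nat.nle_gt; intro L. apply N. rewrite <- (dyad_refine m n j).
    apply (dyad_mono _ (2 ^ m * k)); auto.
    rewrite (Nat.add_comm n m), dyad_refine. exact H. }
  apply lt_INR in L. rewrite !mult_INR, !pow_INR in L. cbn [INR] in L.
  replace (1 + 1) with 2 in L by lra.
  assert (A : 0 < 2 ^ n) by (apply pow_lt; lra).
  assert (B : 0 < 2 ^ m) by (apply pow_lt; lra).
  apply (Rmult_le_reg_r (2 ^ n * 2 ^ m)); [nra|].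
  field_simplify; lra.
Qed.

Lemma dyad_two n x : u n (2 ^ n * 2) x.
Proof.
  generalize (dyad_refine 0 n 2). rewrite Nat.add_0_r. intros ->. exact I.
Qed.

Lemma urysohn_level x : exists r, 0 <= r /\
  (forall n k, ~ u n k x -> INR k / 2 ^ n <= r) /\ (forall n k, u n k x -> r <= INR k / 2 ^ n).
Proof.
  (* The value is the supremum of the levels that miss [x]. Adding 0 keeps the set non-empty and the
     value nonnegative; 2 is a bound because level 2 is the whole space. *)
  destruct (completeness (fun r => r = 0 \/ exists n k, r = INR k / 2 ^ n /\ ~ u n k x))
    as [r [Hu Hl]].
  - exists 2. intros r [->|[n [k [-> N]]]]; [lra|].
    pose proof (dyad_le 0 2 n k x I N) as L. cbn in L. lra.
  - exists 0; auto.
  - exists r; split; [apply Hu; auto | split].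
    + intros n k N. apply Hu; right; eauto.
    + intros n k H. apply Hl. intros r' [->|[m [j [-> N]]]].
      * apply Rmult_le_pos; [apply pos_INR|]. apply Rlt_le, Rinv_0_lt_compat, pow_lt; lra.
      * apply (dyad_le _ _ _ _ x); auto.
Qed.

Lemma first_level n x : exists k, u n k x /\ forall j, (j < k)%nat -> ~ u n j x.
Proof.
  destruct (classic (exists k, u n k x /\ forall j, (j < k)%nat -> ~ u n j x)) as [H|H]; auto.
  exfalso. assert (forall m j, (j < m)%nat -> ~ u n j x).
  { induction m; intros j L Hj; [lia|]. apply H; exists j; split; auto.
    intros i Li. apply IHm; lia. }
  exact (H0 _ _ (Nat.lt_succ_diag_r _) (dyad_two n x)).
Qed.

Lemma urysohn_dyadic : exists f : X -> R, (forall x, 0 <= f x) /\ (forall x, P0 x -> f x = 0) /\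
  (forall x, ~ Q0 x -> 1 <= f x) /\
  forall x eps, eps > 0 -> exists U, is_open U /\ U x /\ forall y, U y -> Rabs (f y - f x) < eps.
Proof.
  destruct (choice _ urysohn_level) as [f Hf]. exists f. repeat split.
  - intro x; apply Hf.
  - intros x Px. destruct (Hf x) as [L [_ H]]. specialize (H 0%nat 0%nat Px). cbn in H. lra.
  - intros x Nx. destruct (Hf x) as [_ [H _]]. specialize (H 0%nat 1%nat Nx). cbn in H. lra.
  - intros x eps He.
    destruct (pow_lt_1_zero (/2)) with (y := eps / 2) as [n Hn];
      [rewrite Rabs_right; lra | lra |].
    specialize (Hn n (Nat.le_refl n)).
    assert (A : 0 < 2 ^ n) by (apply pow_lt; lra).
    assert (B : / 2 ^ n < eps / 2).
    { rewrite pow_inv in Hn. rewrite Rabs_right in Hn; auto.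
      apply Rle_ge, Rlt_le, Rinv_0_lt_compat, A. }
    destruct (first_level n x) as [k [Hk Nk]].
    (* Level [k] is the first to contain [x], and the closure of level [k - 2] lies in level
       [k - 1], so [x] avoids it. On this neighbourhood the values stay in a window of width
       [2 / 2 ^ n] below [k / 2 ^ n]. For [k < 2] nothing is removed and nonnegativity gives the
       lower bound. *)
    exists (fun y => u n k y /\ ~ closure (fun z => exists j, k = S (S j) /\ u n j z) y).
    split; [|split; [split; auto|]].
    + apply open_inter; [apply dyad_spec | apply closed_closure].
    + intro C. destruct k as [|[|j]].
      * destruct (C _ (open_full X) I) as [y [_ [j [E _]]]]; lia.
      * destruct (C _ (open_full X) I) as [y [_ [j [E _]]]]; lia.
      * apply (Nk (S j)); [lia|]. apply (proj2 (dyad_spec n j)).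
        intros W HW Wx. destruct (C W HW Wx) as [y [Wy [i [E Hi]]]].
        injection E as ->. eauto.
    + intros y [Hy Ny].
      destruct (Hf x) as [Px [Lx Ux]]. destruct (Hf y) as [Py [Ly Uy]].
      specialize (Ux n k Hk). specialize (Uy n k Hy).
      assert (Bx : INR k / 2 ^ n - / 2 ^ n * 2 <= f x).
      { destruct k as [|j].
        - cbn [INR] in *. assert (0 < / 2 ^ n) by (apply Rinv_0_lt_compat, A). unfold Rdiv in *. lra.
        - specialize (Lx n j (Nk j (Nat.lt_succ_diag_r j))). rewrite S_INR in *.
          assert (0 < / 2 ^ n) by (apply Rinv_0_lt_compat, A). unfold Rdiv in *. lra. }
      assert (By : INR k / 2 ^ n - / 2 ^ n * 2 <= f y).
      { assert (0 < / 2 ^ n) by (apply Rinv_0_lt_compat, A).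
        destruct k as [|[|j]].
        - cbn [INR] in *. unfold Rdiv in *. lra.
        - cbn [INR] in *. unfold Rdiv in *. lra.
        - assert (Nj : ~ u n j y) by (intro Q; apply Ny, closure_incl; eauto).
          specialize (Ly n j Nj). rewrite !S_INR in *. unfold Rdiv in *. lra. }
      apply Rabs_def1; lra.
Qed.
End Urysohn.

(** * Limits along filters and continuity on a subset *)

(** An arbitrary filter lets continuity at a point ([nbhd]) and limits along the trace of a point of
    [bX] ([trace]) share the same limit laws. *)
Definition flim {T : Type} (N : (T -> Prop) -> Prop) (f : T -> R) (l : R) : Prop :=
  forall eps, eps > 0 -> N (fun y => Rabs (f y - l) < eps).

Record is_filter {T : Type} (N : (T -> Prop) -> Prop) : Prop := {
  filter_full : N (fun _ => True);
  filter_inter : forall P Q, N P -> N Q -> N (fun y => P y /\ Q y);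
  filter_mono : forall P Q : T -> Prop, (forall y, P y -> Q y) -> N P -> N Q
}.

Section Limits.
Context {T : Type} (N : (T -> Prop) -> Prop) (HN : is_filter N).

Lemma flim_const c : flim N (fun _ => c) c.
Proof.
  intros eps He. apply (filter_mono N HN (fun _ => True)); [|apply (filter_full N HN)].
  intros _ _. rewrite Rminus_diag, Rabs_R0. exact He.
Qed.

Lemma flim_plus f g a b : flim N f a -> flim N g b -> flim N (fun y => f y + g y) (a + b).
Proof.
  intros Hf Hg eps He.
  assert (E2 : eps / 2 > 0) by lra.
  eapply (filter_mono N HN); [|exact (filter_inter N HN _ _ (Hf _ E2) (Hg _ E2))].
  intros y [A B]; cbn in *. replace (f y + g y - (a + b)) with ((f y - a) + (g y - b)) by ring.
  eapply Rle_lt_trans; [apply Rabs_triang|lra].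
Qed.

Lemma flim_mult f g a b : flim N f a -> flim N g b -> flim N (fun y => f y * g y) (a * b).
Proof.
  intros Hf Hg eps He.
  pose proof (Rabs_pos a) as Pa. pose proof (Rabs_pos b) as Pb.
  (* With both factors within [d <= 1] of their limits, the error is at most
     [d * d + |a| d + |b| d], hence at most [d * M]. *)
  set (M := Rabs a + Rabs b + 1).
  assert (HM : 0 < M) by (unfold M; lra).
  set (d := Rmin 1 (eps / (2 * M))).
  assert (E : 0 < eps / (2 * M)) by (apply Rdiv_lt_0_compat; lra).
  assert (Hd : d > 0) by (apply Rmin_glb_lt; lra).
  assert (D1 : d <= 1) by apply Rmin_l.
  assert (D2 : d * M <= eps / 2).
  { replace (eps / 2) with (eps / (2 * M) * M) by (field; lra).
    apply Rmult_le_compat_r; [lra | apply Rmin_r]. }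
  eapply (filter_mono N HN); [|exact (filter_inter N HN _ _ (Hf d Hd) (Hg d Hd))].
  intros y [A B]; cbn in *.
  replace (f y * g y - a * b) with ((f y - a) * (g y - b) + (a * (g y - b) + b * (f y - a))) by ring.
  eapply Rle_lt_trans; [apply Rabs_triang|].
  eapply Rle_lt_trans; [apply Rplus_le_compat_l, Rabs_triang|].
  rewrite !Rabs_mult.
  pose proof (Rabs_pos (f y - a)). pose proof (Rabs_pos (g y - b)).
  assert (Rabs (f y - a) * Rabs (g y - b) <= d * 1) by nra.
  assert (Rabs a * Rabs (g y - b) <= Rabs a * d) by nra.
  assert (Rabs b * Rabs (f y - a) <= Rabs b * d) by nra.
  assert (d * 1 + (Rabs a * d + Rabs b * d) = d * M) by (unfold M; ring).
  lra.
Qed.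

Lemma flim_inv f a : a <> 0 -> flim N f a -> flim N (fun y => / f y) (/ a).
Proof.
  intros Ha Hf eps He.
  assert (Pa : 0 < Rabs a) by (apply Rabs_pos_lt; exact Ha).
  (* The first bound keeps [|f y|] above [|a| / 2]; the second then makes [|f y - a| / |a f y|]
     smaller than [eps]. *)
  set (d := Rmin (Rabs a / 2) (eps * (Rabs a * (Rabs a / 2)))).
  assert (Hd : d > 0) by (apply Rmin_glb_lt; [lra | apply Rmult_lt_0_compat; [lra | nra]]).
  eapply (filter_mono N HN); [|exact (Hf d Hd)].
  intros y A; cbn in *.
  assert (A1 : Rabs (f y - a) < Rabs a / 2) by (eapply Rlt_le_trans; [exact A | apply Rmin_l]).
  assert (A2 : Rabs (f y - a) < eps * (Rabs a * (Rabs a / 2)))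
    by (eapply Rlt_le_trans; [exact A | apply Rmin_r]).
  assert (B : Rabs a / 2 < Rabs (f y)).
  { pose proof (Rabs_triang (a - f y) (f y)) as T1. rewrite Rabs_minus_sym in A1.
    replace (a - f y + f y) with a in T1 by ring. lra. }
  assert (Hy : f y <> 0) by (intros E; rewrite E, Rabs_R0 in B; lra).
  replace (/ f y - / a) with ((a - f y) * / (a * f y)) by (field; auto).
  rewrite Rabs_mult, Rabs_inv, Rabs_mult, Rabs_minus_sym.
  apply (Rmult_lt_reg_r (Rabs a * Rabs (f y))); [nra|].
  rewrite Rmult_assoc, Rinv_l, Rmult_1_r by nra.
  eapply Rlt_le_trans; [exact A2|].
  apply Rmult_le_compat_l; [lra|]. apply Rmult_le_compat_l; lra.
Qed.

Lemma flim_lipschitz (phi : R -> R) f a :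
  (forall r s, Rabs (phi r - phi s) <= Rabs (r - s)) -> flim N f a ->
  flim N (fun y => phi (f y)) (phi a).
Proof.
  intros Hp Hf eps He. eapply (filter_mono N HN); [|exact (Hf eps He)].
  intros y A; cbn in *. eapply Rle_lt_trans; [apply Hp | exact A].
Qed.
End Limits.

Lemma one_minus_lipschitz r s : Rabs ((1 - r) - (1 - s)) <= Rabs (r - s).
Proof. rewrite (Rabs_minus_sym r). apply Req_le. f_equal; ring. Qed.

Lemma one_plus_abs_lipschitz r s : Rabs ((1 + Rabs r) - (1 + Rabs s)) <= Rabs (r - s).
Proof.
  replace (1 + Rabs r - (1 + Rabs s)) with (Rabs r - Rabs s) by ring. apply Rabs_triang_inv2.
Qed.

Lemma clamp_lipschitz r s : Rabs (Rmin (Rabs r) 1 - Rmin (Rabs s) 1) <= Rabs (r - s).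
Proof.
  eapply Rle_trans; [|apply Rabs_triang_inv2].
  generalize (Rabs r) as a, (Rabs s) as b; intros a b.
  unfold Rmin; destruct (Rle_dec a 1), (Rle_dec b 1); unfold Rabs;
    repeat destruct Rcase_abs; lra.
Qed.

Definition nbhd {X : Space} (D : X -> Prop) (x : X) (P : X -> Prop) : Prop :=
  exists U, is_open U /\ U x /\ forall y, U y -> D y -> P y.

(** Continuity of the restriction to [D], stated for total functions to keep subspace types out of
    [collapse_index]. *)
Definition cont_on {X : Space} (D : X -> Prop) (f : X -> R) : Prop :=
  forall x, D x -> flim (nbhd D x) f (f x).

Lemma nbhd_filter {X : Space} (D : X -> Prop) (x : X) : is_filter (nbhd D x).
Proof.
  split.
  - exists (fun _ => True); repeat split; auto using open_full.
  - intros P Q [U [HU [Ux SU]]] [V [HV [Vx SV]]].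
    exists (fun y => U y /\ V y). split; [apply open_inter; auto|]. split; auto.
    intros y [Uy Vy] Dy; auto.
  - intros P Q H [U [HU [Ux S]]]. exists U; auto.
Qed.

Lemma R_open_ball c r : R_open (fun y => Rabs (y - c) < r).
Proof.
  intros x Hx. exists (r - Rabs (x - c)). split; [lra|].
  intros y Hy. replace (y - c) with ((y - x) + (x - c)) by ring.
  eapply Rle_lt_trans; [apply Rabs_triang | lra].
Qed.

Lemma R_open_lt c : R_open (fun y => y < c).
Proof.
  intros x Hx. exists (c - x). split; [lra|]. intros y Hy.
  apply Rabs_def2 in Hy. lra.
Qed.

Lemma continuous_cont_on {X : Space} (f : X -> RSpace) (D : X -> Prop) :
  continuous f -> cont_on D f.
Proof.
  intros Hf x Dx eps He. exists (fun y => Rabs (f y - f x) < eps).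
  split; [apply (Hf _ (R_open_ball (f x) eps))|]. split; auto.
  rewrite Rminus_diag, Rabs_R0. exact He.
Qed.

Lemma cont_on_continuous {X : Space} (f : X -> RSpace) :
  cont_on (fun _ => True) f -> continuous f.
Proof.
  intros Hf V HV. apply open_local. intros x Vx.
  destruct (HV (f x) Vx) as [eps [He Hb]].
  destruct (Hf x I eps He) as [U [HU [Ux S]]].
  exists U; repeat split; auto.
Qed.

Lemma urysohn {X : Space} (A B : X -> Prop) :
  compact X -> hausdorff X -> is_closed A -> is_closed B -> (forall x, A x -> B x -> False) ->
  exists f : X -> RSpace, continuous f /\ (forall x, 0 <= f x <= 1) /\
    (forall x, A x -> f x = 0) /\ (forall x, B x -> f x = 1).
Proof.
  intros HX H2 HA HB D.
  destruct (compact_hausdorff_normal A B HX H2 HA HB D) as [U [V [HU [HV [AU [BV E]]]]]].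
  destruct (urysohn_dyadic X HX H2 U (fun x => ~ B x) HU HB) as [f [Pf [Zf [Of Cf]]]].
  { intros x Cx Bx. destruct (Cx V HV (BV x Bx)) as [y [Vy Uy]]; eauto. }
  exists (fun x => Rmin (Rabs (f x)) 1). repeat split.
  - apply cont_on_continuous. intros x _.
    apply (flim_lipschitz _ (nbhd_filter _ x) (fun r => Rmin (Rabs r) 1)); [apply clamp_lipschitz|].
    intros eps He. destruct (Cf x eps He) as [W [HW [Wx S]]]. exists W; auto.
  - apply Rmin_glb; [apply Rabs_pos | lra].
  - apply Rmin_r.
  - intros x Ax. rewrite Zf, Rabs_R0 by auto. apply Rmin_left; lra.
  - intros x Bx. apply Rmin_right. rewrite Rabs_right; [apply Of | apply Rle_ge, Pf]. tauto.
Qed.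

(** The bound matters: it lets the composite with a map from [X] extend over [bX]. *)
Lemma tychonoff_bounded_separation {X : Space} (V : X -> Prop) (x : X) :
  tychonoff X -> is_open V -> V x ->
  exists f : X -> RSpace, continuous f /\ (forall y, 0 <= f y <= 1) /\ f x = 0 /\
    forall y, f y < 1 -> V y.
Proof.
  intros [HC _] HV Vx.
  destruct (HC (fun y => ~ V y) x (closed_compl _ HV)) as [f [Cf [Zf Of]]]; [tauto|].
  exists (fun y => Rmin (Rabs (f y)) 1). repeat split.
  - apply cont_on_continuous. intros y _.
    apply (flim_lipschitz _ (nbhd_filter _ y) (fun r => Rmin (Rabs r) 1)); [apply clamp_lipschitz|].
    apply continuous_cont_on; auto.
  - apply Rmin_glb; [apply Rabs_pos | lra].
  - apply Rmin_r.
  - rewrite Zf, Rabs_R0. apply Rmin_left; lra.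
  - intros y Hy. apply NNPP; intro N. rewrite (Of y N), Rabs_R1, Rmin_left in Hy; lra.
Qed.

(** * Limits along traces on X of points of bX *)

Lemma RSpace_hausdorff : hausdorff RSpace.
Proof.
  intros x y N. set (d := Rabs (x - y) / 2).
  assert (Hd : 0 < d) by (unfold d; apply Rdiv_lt_0_compat; [apply Rabs_pos_lt; cbn in *; lra | lra]).
  exists (fun z => Rabs (z - x) < d), (fun z => Rabs (z - y) < d).
  split; [apply R_open_ball|]. split; [apply R_open_ball|].
  rewrite !Rminus_diag, !Rabs_R0. repeat split; auto.
  intros z A B. pose proof (Rabs_triang (x - z) (z - y)) as T.
  replace (x - z + (z - y)) with (x - y) in T by ring.
  rewrite Rabs_minus_sym in A. unfold d in *. cbn in *. lra.
Qed.

Lemma eq_of_abs_small a b : (forall eps, eps > 0 -> Rabs (a - b) < eps) -> a = b.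
Proof.
  intros H. destruct (Req_dec a b) as [E|N]; auto.
  assert (P : Rabs (a - b) > 0) by (apply Rabs_pos_lt; lra). specialize (H _ P). lra.
Qed.

(** Expresses that [f] extends continuously to [p] with value [t], without forming the space
    obtained by adding [p] to [X]. *)
Definition tends {X bX T : Space} (e : X -> bX) (f : X -> T) (p : bX) (t : T) : Prop :=
  forall V, is_open V -> V t -> exists W, is_open W /\ W p /\ forall x, W (e x) -> V (f x).

Definition trace {X bX : Space} (e : X -> bX) (p : bX) (P : X -> Prop) : Prop :=
  exists W, is_open W /\ W p /\ forall x, W (e x) -> P x.

Lemma trace_filter {X bX : Space} (e : X -> bX) p : is_filter (trace e p).
Proof.
  split.
  - exists (fun _ => True); repeat split; auto using open_full.
  - intros P Q [U [HU [Ux SU]]] [V [HV [Vx SV]]].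
    exists (fun y => U y /\ V y). split; [apply open_inter; auto|]. split; auto.
    intros x [Ux' Vx']; auto.
  - intros P Q H [U [HU [Ux S]]]. exists U; auto.
Qed.

Lemma tends_flim {X bX : Space} (e : X -> bX) (f : X -> RSpace) p y :
  tends e f p y <-> flim (trace e p) f y.
Proof.
  split.
  - intros H eps He. apply (H (fun z => Rabs (z - y) < eps)); [apply R_open_ball|].
    rewrite Rminus_diag, Rabs_R0; exact He.
  - intros H V HV Vy. destruct (HV y Vy) as [eps [He S]].
    destruct (H eps He) as [W [HW [Wp D]]]. exists W; auto.
Qed.

Lemma tends_comp {X bX T T' : Space} (e : X -> bX) (f : X -> T) (h : T -> T') p t :
  continuous h -> tends e f p t -> tends e (fun x => h (f x)) p (h t).
Proof. intros Hh Hf V HV Vt. exact (Hf _ (Hh V HV) Vt). Qed.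

Section StoneCech.
Context {X bX : Space} {e : X -> bX} (SC : stone_cech X bX e).

Lemma stone_cech_compact : compact bX.
Proof. apply SC. Qed.

Lemma stone_cech_hausdorff : hausdorff bX.
Proof. apply SC. Qed.

Lemma stone_cech_embedding : embedding e.
Proof. apply SC. Qed.

Lemma trace_hit (W : bX -> Prop) p : is_open W -> W p -> exists x, W (e x).
Proof.
  intros HW Wp. destruct SC as [_ [_ [_ [Hd _]]]].
  destruct (Hd W HW (ex_intro _ p Wp)) as [y [Wy [x ->]]]. eauto.
Qed.

Lemma tends_unique {T : Space} (f : X -> T) p t t' :
  hausdorff T -> tends e f p t -> tends e f p t' -> t = t'.
Proof.
  intros HT A B. apply NNPP; intro N.
  destruct (HT t t' N) as [U [V [HU [HV [Ut [Vt D]]]]]].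
  destruct (A U HU Ut) as [W [HW [Wp SW]]]. destruct (B V HV Vt) as [W' [HW' [Wp' SW']]].
  destruct (trace_hit (fun q => W q /\ W' q) p) as [x [A1 A2]]; auto using open_inter.
  eauto.
Qed.

Lemma tends_point {T : Space} (f : X -> T) x : continuous f -> tends e f (e x) (f x).
Proof.
  intros Hf V HV Vx. destruct stone_cech_embedding as [_ [_ Ho]].
  destruct (Ho _ (Hf V HV)) as [W [HW E]]. exists W. split; auto.
  split; [apply E; exact Vx | intros x'; apply E].
Qed.

Lemma tends_extension (f : X -> RSpace) (g : bX -> RSpace) p :
  continuous g -> (forall x, g (e x) = f x) -> tends e f p (g p).
Proof.
  intros Hg E V HV Vp. exists (fun q => V (g q)). repeat split; auto.
  intros x. rewrite E. auto.
Qed.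

Lemma bounded_extension (f : X -> RSpace) M :
  continuous f -> (forall x, Rabs (f x) <= M) ->
  exists g : bX -> RSpace, continuous g /\ forall x, g (e x) = f x.
Proof. intros Hf HM. apply SC; eauto. Qed.

Lemma tends_extension_value {T : Space} (f : X -> T) (k : T -> RSpace) (g : bX -> RSpace) p t :
  continuous k -> continuous g -> (forall x, g (e x) = k (f x)) -> tends e f p t -> g p = k t.
Proof.
  intros Hk Hg E H.
  apply (tends_unique (fun x => k (f x)) p _ _ RSpace_hausdorff).
  - apply tends_extension; auto.
  - apply tends_comp; auto.
Qed.

Lemma tends_of_values {T : Space} (f : X -> T) p t :
  tychonoff T -> continuous f ->
  (forall (k : T -> RSpace) (g : bX -> RSpace), continuous k -> continuous g ->
     (forall x, g (e x) = k (f x)) -> g p = k t) ->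
  tends e f p t.
Proof.
  intros HT Hf H V HV Vt.
  destruct (tychonoff_bounded_separation V t HT HV Vt) as [k [Ck [Bk [Zk Sk]]]].
  destruct (bounded_extension (fun x => k (f x)) 1) as [g [Cg Eg]].
  - intros U HU. exact (Hf _ (Ck U HU)).
  - intro x. rewrite Rabs_right; [apply Bk | apply Rle_ge, Bk].
  - exists (fun q => g q < 1). split; [exact (Cg _ (R_open_lt 1))|]. split.
    + rewrite (H k g), Zk; auto; lra.
    + intros x Hx. apply Sk. rewrite <- Eg. exact Hx.
Qed.

(** Points of [Z] whose limits approach [t0] cluster somewhere in the compact [bX], and test
    functions identify the limit there as [t0]. With [Z] everything this gives non-empty fibres;
    with [Z] closed it gives continuity of induced maps. *)
Lemma tends_cluster {T : Space} (f : X -> T) (t0 : T) (Z : bX -> Prop) :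
  tychonoff T -> continuous f ->
  (forall V, is_open V -> V t0 -> exists p t, Z p /\ V t /\ tends e f p t) ->
  exists p, closure Z p /\ tends e f p t0.
Proof.
  intros HT Hf H.
  destruct (cluster_nbhd t0 (fun V p => Z p /\ exists t, V t /\ tends e f p t) stone_cech_compact)
    as [p Hp].
  - intros V V' p S [Zp [t [Vt Ht]]]; eauto 6.
  - intros V HV Vt. destruct (H V HV Vt) as [p [t [A [B C]]]]; eauto 6.
  - exists p; split.
    + intros W HW Wp. destruct (Hp _ (open_full T) I W HW Wp) as [q [Wq [Zq _]]]; eauto.
    + apply tends_of_values; auto. intros k g Ck Cg E. apply eq_of_abs_small; intros eps He.
      destruct (Hp (fun t => Rabs (k t - k t0) < eps / 2))
        with (U := fun q => Rabs (g q - g p) < eps / 2)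
        as [q [Wq [_ [t [Vt Ht]]]]].
      * exact (Ck _ (R_open_ball _ _)).
      * rewrite Rminus_diag, Rabs_R0; lra.
      * exact (Cg _ (R_open_ball _ _)).
      * rewrite Rminus_diag, Rabs_R0; lra.
      * rewrite (tends_extension_value f k g q t) in Wq; auto.
        replace (g p - k t0) with (- (k t - g p) + (k t - k t0)) by ring.
        eapply Rle_lt_trans; [apply Rabs_triang|]. rewrite Rabs_Ropp. lra.
Qed.

Lemma tends_fiber_closed {T : Space} (f : X -> T) t :
  tychonoff T -> continuous f -> is_closed (fun q => tends e f q t).
Proof.
  intros HT Hf. apply closed_of_closure. intros p Hp.
  apply tends_of_values; auto. intros k g Ck Cg E. apply eq_of_abs_small; intros eps He.
  destruct (Hp (fun q => Rabs (g q - g p) < eps)) as [q [Wq Hq]].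
  - exact (Cg _ (R_open_ball _ _)).
  - rewrite Rminus_diag, Rabs_R0; lra.
  - rewrite (tends_extension_value f k g q t) in Wq; auto. rewrite Rabs_minus_sym; exact Wq.
Qed.

Lemma tends_embedding_point {T : Space} (f : X -> T) p x :
  embedding f -> tends e f p (f x) -> p = e x.
Proof.
  intros [_ [_ Ho]] H. apply NNPP; intro N.
  destruct (stone_cech_hausdorff p (e x) N) as [U [V [HU [HV [Up [Vx D]]]]]].
  destruct stone_cech_embedding as [_ [Ce _]].
  destruct (Ho _ (Ce V HV)) as [V' [HV' E]].
  destruct (H V' HV') as [W [HW [Wp S]]]; [apply E; exact Vx|].
  destruct (trace_hit (fun q => U q /\ W q) p) as [y [Uy Wy]]; auto using open_inter.
  apply (D (e y) Uy). apply E, S, Wy.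
Qed.

Lemma hewitt_tends p (f : X -> RSpace) : hewitt e p -> continuous f -> exists y : RSpace, tends e f p y.
Proof.
  intros Hp Hf. destruct (Hp f Hf) as [g [Cg E]].
  set (z := exist (fun q => image e q \/ q = p) p (or_intror eq_refl)).
  exists (g z). intros V HV Vz. destruct (Cg V HV) as [W [HW EW]].
  exists W. split; auto. split; [apply (EW z); exact Vz|].
  intros x Wx. rewrite <- (E x (or_introl (ex_intro _ x eq_refl))).
  apply EW. exact Wx.
Qed.

Lemma tends_hewitt p :
  (forall f : X -> RSpace, continuous f -> exists y : RSpace, tends e f p y) -> hewitt e p.
Proof.
  intros H f Hf. destruct (H f Hf) as [y Hy].
  assert (G : forall z : subspace (fun q : bX => image e q \/ q = p),
             exists r : RSpace, tends e f (proj1_sig z) r).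
  { intros [q [[x ->]|E]]; cbn; [exists (f x); apply tends_point; auto | subst q; eauto]. }
  destruct (choice _ G) as [g Hg]. exists g. split.
  - intros V HV. apply open_local. intros [q hq] Vz.
    destruct (HV _ Vz) as [eps [He S]].
    pose proof (proj1 (tends_flim _ _ _ _) (Hg (exist _ q hq)) (eps / 2) ltac:(lra)) as [W [HW [Wq SW]]].
    exists (fun z => W (proj1_sig z)). split; [exists W; split; [auto | tauto]|]. split; [exact Wq|].
    intros z Wz. apply S.
    pose proof (proj1 (tends_flim _ _ _ _) (Hg z) (eps / 2) ltac:(lra)) as [W' [HW' [Wz' SW']]].
    destruct (trace_hit (fun q => W q /\ W' q) (proj1_sig z)) as [x [A B]]; auto using open_inter.
    specialize (SW x A). specialize (SW' x B). cbn in SW, SW', A, B.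
    replace (g z - g (exist _ q hq)) with (- (f x - g z) + (f x - g (exist _ q hq))) by ring.
    eapply Rle_lt_trans; [apply Rabs_triang|]. rewrite Rabs_Ropp. lra.
  - intros x h. apply (tends_unique f (e x) _ _ RSpace_hausdorff).
    + apply (Hg (exist _ (e x) h)).
    + apply tends_point; auto.
Qed.

(* Where [1 / (1 + |f|)] extends by a nonzero value, the quotient of the bounded functions
   [f / (1 + |f|)] and [1 / (1 + |f|)] gives the limit of [f]. *)
Lemma not_hewitt_positive p : ~ hewitt e p ->
  exists g : bX -> RSpace, continuous g /\ g p = 0 /\ forall x, 0 < g (e x).
Proof.
  intros N. apply NNPP; intro M. apply N. apply tends_hewitt. intros f Hf.
  assert (P : forall x, 0 < 1 + Rabs (f x)) by (intro x; pose proof (Rabs_pos (f x)); lra).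
  assert (C0 : continuous (fun x => / (1 + Rabs (f x)) : RSpace)).
  { apply cont_on_continuous. intros x _. apply (flim_inv _ (nbhd_filter _ x)).
    - specialize (P x); lra.
    - apply (flim_lipschitz _ (nbhd_filter _ x) (fun r => 1 + Rabs r)); [apply one_plus_abs_lipschitz|].
      apply continuous_cont_on; auto. }
  destruct (bounded_extension (fun x => / (1 + Rabs (f x))) 1 C0) as [g [Cg Eg]].
  { intro x. pose proof (Rinv_0_lt_compat _ (P x)). rewrite Rabs_right by lra.
    rewrite <- Rinv_1. apply Rinv_le_contravar; [lra|]. pose proof (Rabs_pos (f x)); lra. }
  destruct (bounded_extension (fun x => f x * / (1 + Rabs (f x))) 1) as [g1 [Cg1 Eg1]].
  { apply cont_on_continuous. intros x _. apply (flim_mult _ (nbhd_filter _ x)).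
    - exact (continuous_cont_on f _ Hf x I).
    - exact (continuous_cont_on _ _ C0 x I). }
  { intro x. rewrite Rabs_mult, Rabs_inv, (Rabs_right (1 + _)) by (specialize (P x); lra).
    apply (Rmult_le_reg_r (1 + Rabs (f x))); [apply P|].
    rewrite Rmult_assoc, Rinv_l by (specialize (P x); lra). lra. }
  destruct (Req_dec (g p) 0) as [Z|NZ].
  - exfalso. apply M. exists g. repeat split; auto. intro x. rewrite Eg.
    apply Rinv_0_lt_compat, P.
  - exists (g1 p * / g p). apply tends_flim.
    assert (L : flim (trace e p) (fun x => (f x * / (1 + Rabs (f x))) * / (/ (1 + Rabs (f x))))
                  (g1 p * / g p)).
    { apply (flim_mult _ (trace_filter e p)).
      - apply tends_flim, tends_extension; auto.
      - apply (flim_inv _ (trace_filter e p)); auto. apply tends_flim, tends_extension; auto. }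
    intros eps He. eapply (filter_mono _ (trace_filter e p)); [|exact (L eps He)].
    intros x. cbn beta.
    rewrite Rinv_inv, Rmult_assoc, Rinv_l, Rmult_1_r by (specialize (P x); lra). auto.
Qed.

(** * The relation encoding an extension *)

(** The reflexive pairs mark the points outside [X] at which a limit in [A] exists, so one relation
    records both the domain and the identifications. *)
Definition remainder_rel (A : Ext X) (p q : bX) : Prop :=
  ~ image e p /\ ~ image e q /\
  exists t, tends e (ext_emb A) p t /\ tends e (ext_emb A) q t.

Lemma ext_emb_continuous (A : Ext X) : continuous (ext_emb A).
Proof. apply (ext_embedding _ A). Qed.

Lemma ext_hausdorff (A : Ext X) : hausdorff (ext_space A).
Proof. apply (ext_tych _ A). Qed.

Lemma ext_tends_surjective (A : Ext X) t : exists p, tends e (ext_emb A) p t.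
Proof.
  destruct (tends_cluster (ext_emb A) t (fun _ => True) (ext_tych _ A) (ext_emb_continuous A))
    as [p [_ Hp]]; eauto.
  intros V HV Vt. destruct (ext_dense _ A V HV (ex_intro _ t Vt)) as [s [Vs [x ->]]].
  exists (e x), (ext_emb A x). repeat split; auto. apply tends_point, ext_emb_continuous.
Qed.

Lemma ext_tends_image (A : Ext X) p t :
  tends e (ext_emb A) p t -> (image e p <-> image (ext_emb A) t).
Proof.
  intros H; split; intros [x ->].
  - exists x. apply (tends_unique (ext_emb A) (e x)); auto using ext_hausdorff.
    apply tends_point, ext_emb_continuous.
  - exists x. apply (tends_embedding_point (ext_emb A)); auto. apply ext_embedding.
Qed.

Lemma remainder_rel_sym A p q : remainder_rel A p q -> remainder_rel A q p.
Proof. intros [Np [Nq [t [Hp Hq]]]]; repeat split; eauto. Qed.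

Lemma remainder_rel_trans A p q r :
  remainder_rel A p q -> remainder_rel A q r -> remainder_rel A p r.
Proof.
  intros [Np [Nq [t [Hp Hq]]]] [_ [Nr [s [Hq' Hr]]]]. repeat split; auto.
  assert (s = t) as -> by (apply (tends_unique (ext_emb A) q); auto using ext_hausdorff).
  eauto.
Qed.

Lemma remainder_rel_class_closed A p :
  remainder_rel A p p -> is_closed (fun q => remainder_rel A p q).
Proof.
  intros [Np [_ [t [Hp _]]]].
  eapply open_ext; [exact (tends_fiber_closed (ext_emb A) t (ext_tych _ A) (ext_emb_continuous A))|].
  intro q. cut (tends e (ext_emb A) q t <-> remainder_rel A p q); [tauto|]. split.
  - intros Hq. split; [exact Np|]. split; [|eauto]. intro Iq. apply Np.
    apply (ext_tends_image A p t Hp). apply (ext_tends_image A q t Hq). exact Iq.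
  - intros [_ [_ [s [Hp' Hq]]]].
    assert (t = s) as -> by (apply (tends_unique (ext_emb A) p); auto using ext_hausdorff).
    exact Hq.
Qed.

(** Compactness of the remainder gives the limits at points near [p] a cluster point [t] outside
    [X]; test functions show that [t] is the limit at [p]. *)
Lemma remainder_rel_domain_closed A : compact (remainder A) ->
  is_closed (fun p => remainder_rel A p p).
Proof.
  intros HA. apply closed_of_closure. intros p Hp.
  destruct (cluster_nbhd p
              (fun W (s : remainder A) => exists q, W q /\ tends e (ext_emb A) q (proj1_sig s)) HA)
    as [[t Nt] Ht].
  - intros V V' s S [q [Vq Hq]]; eauto.
  - intros W HW Wp. destruct (Hp W HW Wp) as [q [Wq [Nq [_ [t [Hq _]]]]]].
    assert (Nt : ~ image (ext_emb A) t) by (intro Q; apply Nq, (ext_tends_image A q t); auto).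
    exists (exist _ t Nt); eauto.
  - assert (H : tends e (ext_emb A) p t).
    { apply tends_of_values; [apply ext_tych | apply ext_emb_continuous |].
      intros k g Ck Cg E. apply eq_of_abs_small; intros eps He.
      destruct (Ht (fun q => Rabs (g q - g p) < eps / 2))
        with (U := fun s : remainder A => Rabs (k (proj1_sig s) - k t) < eps / 2)
        as [s [Ws [q [Wq Hq]]]].
      * exact (Cg _ (R_open_ball _ _)).
      * rewrite Rminus_diag, Rabs_R0; lra.
      * exists (fun s => Rabs (k s - k t) < eps / 2).
        split; [exact (Ck _ (R_open_ball _ _)) | tauto].
      * cbn. rewrite Rminus_diag, Rabs_R0; lra.
      * rewrite (tends_extension_value (ext_emb A) k g q (proj1_sig s)) in Wq; auto.
        replace (g p - k t) with (- (k (proj1_sig s) - g p) + (k (proj1_sig s) - k t)) by ring.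
        eapply Rle_lt_trans; [apply Rabs_triang|]. rewrite Rabs_Ropp. lra. }
    assert (Np : ~ image e p) by (intro Q; apply Nt, (ext_tends_image A p t); auto).
    repeat split; eauto.
Qed.

(** The coordinate limits form a point of the power. It lies in the image of [T], since otherwise
    the open complement of that image would contain some [i (f x)]. *)
Lemma tends_power_coordinates {T : Space} (I : Type) (i : T -> Rpower I) (f : X -> T) p :
  embedding i -> is_closed (image i) ->
  (forall j, exists r : RSpace, tends e (fun x => i (f x) j : RSpace) p r) ->
  exists t, tends e f p t.
Proof.
  intros [Hinj [Ci Hi]] Hc H. destruct (choice _ H) as [y Hy].
  assert (L : forall V, prod_open I V -> V y ->
               exists W, is_open W /\ W p /\ forall x, W (e x) -> V (i (f x))).
  { intros V HV Vy. destruct (HV y Vy) as [l [A B]].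
    assert (M : exists W, is_open W /\ W p /\ forall x, W (e x) ->
                 forall q, In q l -> snd q (i (f x) (fst q))).
    { clear B. induction l as [|q l IH].
      - exists (fun _ => True); repeat split; auto using open_full. intros x _ q [].
      - destruct IH as [W [HW [Wp S]]]; [intros; apply A; right; auto|].
        destruct (A q (or_introl eq_refl)) as [Oq Vq].
        destruct (Hy (fst q) (snd q) Oq Vq) as [W' [HW' [Wp' S']]].
        exists (fun z => W z /\ W' z). split; [apply open_inter; auto|]. split; auto.
        intros x [Wx Wx'] q' [<-|Hq']; auto. }
    destruct M as [W [HW [Wp S]]]. exists W; auto. }
  assert (Hy' : image i y).
  { apply NNPP; intro N. destruct (L _ Hc N) as [W [HW [Wp S]]].
    destruct (trace_hit W p HW Wp) as [x Wx]. apply (S x Wx). exists (f x); auto. }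
  destruct Hy' as [t ->]. exists t. intros V HV Vt.
  destruct (Hi V HV) as [V' [HV' E]].
  destruct (L V' HV') as [W [HW [Wp S]]]; [apply E; exact Vt|].
  exists W. repeat split; auto. intros x Wx. apply E; auto.
Qed.

Lemma coordinate_continuous (I : Type) (j : I) : continuous (fun y : Rpower I => y j : RSpace).
Proof.
  intros V HV y Vy. exists ((j, V) :: nil). split.
  - intros q [<-|[]]; auto.
  - intros z Hz. exact (Hz (j, V) (or_introl eq_refl)).
Qed.

Lemma realcompact_tends_hewitt {T : Space} (f : X -> T) p :
  realcompact T -> continuous f -> hewitt e p -> exists t, tends e f p t.
Proof.
  intros [I [i [Hi Hc]]] Hf Hp. apply (tends_power_coordinates I i f p Hi Hc).
  intro j. apply hewitt_tends; auto. intros V HV.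
  exact (Hf _ (proj1 (proj2 Hi) _ (coordinate_continuous I j V HV))).
Qed.

(** Realcompactness puts the Hewitt points outside [X] into the domain, and compactness of the
    remainder adds their closure. *)
Lemma cl_hewitt_remainder_domain A p : in_RX A -> cl_hewitt_remainder e p -> remainder_rel A p p.
Proof.
  intros [HR HC].
  apply (closure_sub_closed _ (fun q => remainder_rel A q q) (remainder_rel_domain_closed A HC)).
  intros q [Hq Nq].
  destruct (realcompact_tends_hewitt (ext_emb A) q HR (ext_emb_continuous A) Hq) as [t Ht].
  repeat split; eauto.
Qed.

Lemma ext_le_remainder_rel A B : ext_le A B ->
  forall p q, remainder_rel B p q -> remainder_rel A p q.
Proof.
  intros [f [Cf Ef]] p q [Np [Nq [t [Hp Hq]]]]. repeat split; auto. exists (f t).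
  assert (E : ext_emb A = fun x => f (ext_emb B x))
    by (apply functional_extensionality; intro x; symmetry; apply Ef).
  rewrite E. split; apply tends_comp; auto.
Qed.

Lemma remainder_rel_ext_le A B :
  (forall p q, remainder_rel B p q -> remainder_rel A p q) -> ext_le A B.
Proof.
  intros H.
  (* The map sends [t] to the limit in [A] at any point of the fibre of [t]. Fibres over [X] are
     single points; over the remainder the inclusion says that the limit exists and is constant on
     the fibre. *)
  assert (G : forall t, exists s, forall p, tends e (ext_emb B) p t -> tends e (ext_emb A) p s).
  { intro t. destruct (ext_tends_surjective B t) as [p Hp].
    destruct (classic (image (ext_emb B) t)) as [[x ->]|N].
    - exists (ext_emb A x). intros q Hq.
      rewrite (tends_embedding_point (ext_emb B) q x); auto.
      + apply tends_point, ext_emb_continuous.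
      + apply ext_embedding.
    - assert (M : forall q, tends e (ext_emb B) q t -> ~ image e q)
        by (intros q Hq Q; apply N, (ext_tends_image B q t); auto).
      assert (Rp : remainder_rel B p p) by (repeat split; eauto).
      destruct (H p p Rp) as [_ [_ [s [Hs _]]]]. exists s. intros q Hq.
      assert (Rq : remainder_rel B p q) by (repeat split; eauto).
      destruct (H p q Rq) as [_ [_ [s' [Hs' Hq']]]].
      rewrite (tends_unique (ext_emb A) p s s'); auto using ext_hausdorff. }
  destruct (choice _ G) as [f Hf]. exists f. split.
  - intros V HV. apply open_local. intros t0 Vt0. apply NNPP; intro N.
    destruct (tychonoff_bounded_separation V (f t0) (ext_tych _ A) HV Vt0) as [k [Ck [Bk [Zk Sk]]]].
    destruct (bounded_extension (fun x => k (ext_emb A x)) 1) as [g [Cg Eg]].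
    { intros U HU. exact (ext_emb_continuous A _ (Ck U HU)). }
    { intro x. rewrite Rabs_right; [apply Bk | apply Rle_ge, Bk]. }
    (* If [f] were discontinuous at [t0], points with [g] at least 1 would have limits arbitrarily
       near [t0]. They cluster at a point of the fibre of [t0] where [g] is still at least 1,
       whereas [k] vanishes at [f t0]. *)
    destruct (tends_cluster (ext_emb B) t0 (fun q => ~ g q < 1) (ext_tych _ B) (ext_emb_continuous B))
      as [p [Hp Tp]].
    { intros U HU Ut0. apply NNPP; intro M. apply N. exists U. repeat split; auto.
      intros t Ut. apply NNPP; intro Q. apply M.
      destruct (ext_tends_surjective B t) as [p Hp]. exists p, t. repeat split; auto.
      rewrite (tends_extension_value (ext_emb A) k g p (f t)); auto. }
    apply (closure_sub_closed _ _ (closed_compl (fun q => g q < 1) (Cg _ (R_open_lt 1)))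
             (fun q Hq => Hq)) in Hp.
    apply Hp. rewrite (tends_extension_value (ext_emb A) k g p (f t0)); auto. rewrite Zk; lra.
  - intro x. apply (tends_unique (ext_emb A) (e x)); auto using ext_hausdorff.
    + apply Hf, tends_point, ext_emb_continuous.
    + apply tends_point, ext_emb_continuous.
Qed.
End StoneCech.

(** * Extensions collapsing a closed set *)

Arguments remainder_rel {X bX} e A p q.

Lemma subspace_val_continuous {X : Space} (S : X -> Prop) :
  continuous (fun z : subspace S => proj1_sig z).
Proof. intros V HV. exists V; split; [exact HV | tauto]. Qed.

(** The function is a sum of coordinate distances to [y], one per constraint of a basic
    neighbourhood, each divided by the radius allowed there; a sum below 1 satisfies every
    constraint. *)
Lemma power_separation (I : Type) (y : Rpower I) (V : Rpower I -> Prop) :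
  is_open V -> V y ->
  exists f : Rpower I -> RSpace, continuous f /\ f y = 0 /\ forall z, f z < 1 -> V z.
Proof.
  intros HV Vy. destruct (HV y Vy) as [l [A B]].
  assert (M : exists f : Rpower I -> RSpace, continuous f /\ f y = 0 /\ (forall z, 0 <= f z) /\
            forall z, f z < 1 -> forall q, In q l -> snd q (z (fst q))).
  { clear B. induction l as [|[j O] l IH].
    - exists (fun _ => 0). repeat split; try (intros; lra).
      + apply cont_on_continuous. intros x _. apply flim_const, nbhd_filter.
      + intros z _ q [].
    - destruct IH as [f [Cf [Zf [Pf Sf]]]]; [intros; apply A; right; auto|].
      destruct (A (j, O) (or_introl eq_refl)) as [HO Oy]. cbn in HO, Oy.
      destruct (HO _ Oy) as [eps [He S]].
      assert (P : forall z : Rpower I, 0 <= Rabs (z j - y j) * / eps).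
      { intro z. apply Rmult_le_pos; [apply Rabs_pos | apply Rlt_le, Rinv_0_lt_compat; lra]. }
      exists (fun z => f z + Rabs (z j - y j) * / eps). repeat split.
      + apply cont_on_continuous. intros z _. apply (flim_plus _ (nbhd_filter _ z)).
        * exact (continuous_cont_on f _ Cf z Logic.I).
        * apply (flim_mult _ (nbhd_filter _ z)); [|apply flim_const, nbhd_filter].
          apply (flim_lipschitz _ (nbhd_filter _ z) (fun r => Rabs (r - y j))).
          -- intros r s. eapply Rle_trans; [apply Rabs_triang_inv2|].
             replace (r - y j - (s - y j)) with (r - s) by ring. apply Rle_refl.
          -- exact (continuous_cont_on _ _ (coordinate_continuous I j) z Logic.I).
      + rewrite Zf, Rminus_diag, Rabs_R0, Rmult_0_l. apply Rplus_0_l.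
      + intro z. specialize (P z). specialize (Pf z). lra.
      + intros z Hz q [<-|Hq].
        * cbn. apply S. specialize (Pf z). apply (Rmult_lt_reg_r (/ eps)).
          { apply Rinv_0_lt_compat; lra. } rewrite Rinv_r by lra. lra.
        * apply Sf; auto. specialize (P z). lra. }
  destruct M as [f [Cf [Zf [_ Sf]]]]. exists f; auto.
Qed.

Lemma subspace_power_tychonoff (I : Type) (S : Rpower I -> Prop) : tychonoff (subspace S).
Proof.
  split.
  - intros C x [V [HV EV]] Nx.
    destruct (power_separation I (proj1_sig x) V HV) as [f [Cf [Zf Sf]]]; [apply EV; exact Nx|].
    exists (fun z => Rmin (Rabs (f (proj1_sig z))) 1). repeat split.
    + apply cont_on_continuous. intros z _.
      apply (flim_lipschitz _ (nbhd_filter _ z) (fun r => Rmin (Rabs r) 1)); [apply clamp_lipschitz|].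
      assert (Cg : continuous (fun z : subspace S => f (proj1_sig z)))
        by (intros U HU; exact (subspace_val_continuous S _ (Cf U HU))).
      exact (continuous_cont_on _ _ Cg z Logic.I).
    + rewrite Zf, Rabs_R0. apply Rmin_left; lra.
    + intros z Cz. apply Rmin_right. apply Rnot_lt_le; intro L.
      apply (proj2 (EV z)); auto. apply Sf. apply Rabs_def2 in L. lra.
  - intros x y N.
    assert (M : exists j, proj1_sig x j <> proj1_sig y j).
    { apply NNPP; intro Q. apply N. apply eq_sig_hprop; [intros; apply proof_irrelevance|].
      apply functional_extensionality; intro j. apply NNPP; eauto. }
    destruct M as [j Nj].
    destruct (RSpace_hausdorff _ _ Nj) as [U [V [HU [HV [Ux [Vy D]]]]]].
    exists (fun z => U (proj1_sig z j)), (fun z => V (proj1_sig z j)). repeat split; eauto.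
    + exact (subspace_val_continuous S _ (coordinate_continuous I j U HU)).
    + exact (subspace_val_continuous S _ (coordinate_continuous I j V HV)).
Qed.

Lemma subspace_val_embedding {X : Space} (S : X -> Prop) :
  embedding (fun z : subspace S => proj1_sig z).
Proof.
  split; [|split; [apply subspace_val_continuous|]].
  - intros x y E. apply eq_sig_hprop; [intros; apply proof_irrelevance | exact E].
  - intros U [V [HV E]]. exists V; auto.
Qed.

Lemma closed_subspace_power_realcompact (I : Type) (S : Rpower I -> Prop) :
  is_closed S -> realcompact (subspace S).
Proof.
  intros HS. exists I, (fun z => proj1_sig z). split; [apply subspace_val_embedding|].
  eapply open_ext; [exact HS|]. intro y.
  cut (S y <-> image (fun z : subspace S => proj1_sig z) y); [tauto|]. split.
  - intros Sy. exists (exist _ y Sy); reflexivity.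
  - intros [[z Sz] ->]; exact Sz.
Qed.

(** Compactness of a continuous image, with the map given as a relation because its target in the
    application is a doubly nested subspace. *)
Lemma compact_relation_image {X Y : Space} (C : X -> Prop) (r : X -> Y -> Prop) :
  compact X -> is_closed C ->
  (forall p, C p -> exists y, r p y /\
     forall V, is_open V -> V y ->
       exists W, is_open W /\ W p /\ forall q z, W q -> C q -> r q z -> V z) ->
  (forall y, exists p, C p /\ r p y) ->
  compact Y.
Proof.
  intros HX HC Hr Hs F HF HFc.
  (* The alternative of an empty [V] admits the complement of [C], needed to cover all of [X]; such
     members are dropped when the finite list is transferred to [Y]. *)
  destruct (HX (fun W => is_open W /\ exists V, (F V \/ (forall z : Y, ~ V z)) /\
                   forall q z, W q -> C q -> r q z -> V z)) as [l [Hl Hcov]].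
  - tauto.
  - intro p. destruct (classic (C p)) as [Cp|Np].
    + destruct (Hr p Cp) as [y [_ Hy]]. destruct (HFc y) as [V [FV Vy]].
      destruct (Hy V (HF V FV) Vy) as [W [HW [Wp S]]]. exists W. split; auto.
      split; auto. exists V; auto.
    + exists (fun q => ~ C q). repeat split; auto.
      exists (fun _ => False). split; [right; auto|]. tauto.
  - assert (M : exists l', (forall V, In V l' -> F V) /\
        forall W, In W l -> forall q z, W q -> C q -> r q z -> exists V, In V l' /\ V z).
    { clear Hcov. induction l as [|W l IH].
      - exists nil; split; [intros V [] | intros W []].
      - destruct IH as [l' [A B]]; [intros; apply Hl; right; auto|].
        destruct (Hl W (or_introl eq_refl)) as [_ [V [[FV|EV] S]]].
        + exists (V :: l'). split; [intros V' [<-|HV']; auto|].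
          intros W' [<-|HW'] q z Wq Cq Rq.
          * exists V; split; [left; auto | eauto].
          * destruct (B W' HW' q z Wq Cq Rq) as [V' [I' Vz]]. exists V'; split; [right|]; auto.
        + exists l'. split; auto. intros W' [<-|HW'] q z Wq Cq Rq; eauto.
          exfalso; eapply EV; eauto. }
    destruct M as [l' [A B]]. exists l'; split; auto. intro y.
    destruct (Hs y) as [p [Cp Rp]]. destruct (Hcov p) as [W [HW Wp]]. eauto.
Qed.

Lemma power_limit (I : Type) {Z : Type} (N : (Z -> Prop) -> Prop) (f : Z -> Rpower I) (y : Rpower I) :
  is_filter N -> (forall j, flim N (fun z => f z j) (y j)) ->
  forall V : Rpower I -> Prop, is_open V -> V y -> N (fun z => V (f z)).
Proof.
  intros HN Hj V HV Vy. destruct (HV y Vy) as [l [A B]].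
  apply (filter_mono N HN (fun z => forall q, In q l -> snd q (f z (fst q)))); [auto|].
  clear B. induction l as [|q l IH].
  - apply (filter_mono N HN (fun _ => True)); [intros y0 _ q [] | apply (filter_full N HN)].
  - destruct (A q (or_introl eq_refl)) as [Oq Vq]. destruct (Oq _ Vq) as [eps [He S]].
    eapply (filter_mono N HN);
      [|exact (filter_inter N HN _ _ (Hj (fst q) eps He)
                 (IH (fun q' Hq' => A q' (or_intror Hq'))))].
    intros z [P Q] q' [<-|Hq']; auto.
Qed.

Section Collapse.
Context {X bX : Space} {e : X -> bX} (SC : stone_cech X bX e).
Context (KX : forall p, cl_hewitt_remainder e p -> ~ image e p).
Context (F : bX -> Prop) (HF : is_closed F) (FX : forall p, F p -> ~ image e p).

Definition collapse_domain (p : bX) : Prop := image e p \/ cl_hewitt_remainder e p \/ F p.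

(** Boundedness is not imposed: functions blowing up off the domain make the image closed. Constancy
    on [F] performs the identification. *)
Definition collapse_index : Type :=
  {h : bX -> R | cont_on collapse_domain h /\ forall p q, F p -> F q -> h p = h q}.

Definition collapse_eval (p : bX) : Rpower collapse_index := fun j => proj1_sig j p.

Lemma collapse_index_of_continuous (h : bX -> RSpace) :
  continuous h -> (forall p q, F p -> F q -> h p = h q) ->
  exists j : collapse_index, forall p, collapse_eval p j = h p.
Proof.
  intros Ch Eh.
  exists (exist _ (h : bX -> R) (conj (continuous_cont_on h collapse_domain Ch) Eh)).
  reflexivity.
Qed.

Lemma remainder_part_closed : is_closed (fun p => cl_hewitt_remainder e p \/ F p).
Proof. apply closed_or; [apply closed_closure | exact HF]. Qed.

Lemma collapse_eval_continuous p (V : Rpower collapse_index -> Prop) :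
  collapse_domain p -> is_open V -> V (collapse_eval p) ->
  nbhd collapse_domain p (fun q => V (collapse_eval q)).
Proof.
  intros Dp HV Vp. apply (power_limit _ _ _ (collapse_eval p)); auto using nbhd_filter.
  intros [h [Ch Eh]]. exact (Ch p Dp).
Qed.

(* [1 / (g (1 - k) + k)] is a coordinate that blows up at [p]. *)
Lemma collapse_escape p (y : Rpower collapse_index) : ~ collapse_domain p ->
  exists W V, is_open W /\ W p /\ is_open V /\ V y /\
    forall q, collapse_domain q -> W q -> ~ V (collapse_eval q).
Proof.
  intros Np.
  assert (Hp : ~ hewitt e p).
  { intro H. apply Np. right; left. apply closure_incl. split; auto.
    intro Q; apply Np; left; auto. }
  destruct (not_hewitt_positive SC p Hp) as [g [Cg [Zg Pg]]].
  destruct (urysohn (fun q => q = p) (fun q => cl_hewitt_remainder e q \/ F q)) as [k [Ck [Bk [Zk Ok]]]].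
  - apply (stone_cech_compact SC).
  - apply (stone_cech_hausdorff SC).
  - apply closed_point, (stone_cech_hausdorff SC).
  - apply remainder_part_closed.
  - intros q -> Hq. apply Np; right; exact Hq.
  (* [g] is known to be positive only on [X]; the cutoff [k] raises [m] to 1 on the rest of the
     domain, which also makes [m] constant on [F], and leaves [m p = 0]. *)
  - set (m := fun q => g q * (1 - k q) + k q).
    assert (Cm : forall D, cont_on D m).
    { intros D q Dq. unfold m. apply (flim_plus _ (nbhd_filter _ q)).
      - apply (flim_mult _ (nbhd_filter _ q)); [exact (continuous_cont_on g _ Cg q Dq)|].
        apply (flim_lipschitz _ (nbhd_filter _ q) (fun r => 1 - r)); [apply one_minus_lipschitz|].
        exact (continuous_cont_on k _ Ck q Dq).
      - exact (continuous_cont_on k _ Ck q Dq). }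
    assert (Om : forall q, cl_hewitt_remainder e q \/ F q -> m q = 1).
    { intros q Hq. unfold m. rewrite (Ok q Hq). lra. }
    assert (Pm : forall q, collapse_domain q -> 0 < m q).
    { intros q [[x ->]|Hq].
      - unfold m. specialize (Pg x). specialize (Bk (e x)).
        destruct (Rle_lt_or_eq_dec (k (e x)) 1 (proj2 Bk)) as [L|E].
        + assert (0 < g (e x) * (1 - k (e x))) by (apply Rmult_lt_0_compat; lra). lra.
        + rewrite E. lra.
      - rewrite Om by exact Hq. lra. }
    assert (Ch : cont_on collapse_domain (fun q => / m q)).
    { intros q Dq. apply (flim_inv _ (nbhd_filter _ q)); [specialize (Pm q Dq); lra | apply Cm, Dq]. }
    assert (Eh : forall a b, F a -> F b -> / m a = / m b).
    { intros a b Fa Fb. rewrite !Om; auto. }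
    set (j := exist _ (fun q => / m q) (conj Ch Eh) : collapse_index).
    assert (Pj : 0 < Rabs (y j) + 1) by (pose proof (Rabs_pos (y j)); lra).
    destruct (Cm (fun _ => True) p Logic.I (/ (Rabs (y j) + 1))) as [W [HW [Wp SW]]].
    { apply Rinv_0_lt_compat, Pj. }
    exists W, (fun z => Rabs (z j - y j) < 1). repeat split; auto.
    + exact (coordinate_continuous _ j _ (R_open_ball (y j) 1)).
    + rewrite Rminus_diag, Rabs_R0; lra.
    + intros q Dq Wq L. specialize (SW q Wq Logic.I). cbn in L. specialize (Pm q Dq).
      assert (Z : m p = 0) by (unfold m; rewrite Zg, Zk; auto; lra).
      rewrite Z, Rminus_0_r, Rabs_right in SW by lra.
      assert (Q : Rabs (y j) + 1 < / m q).
      { rewrite <- (Rinv_inv (Rabs (y j) + 1)). apply Rinv_lt_contravar; auto.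
        apply Rmult_lt_0_compat; auto. apply Rinv_0_lt_compat, Pj. }
      apply Rabs_def2 in L. pose proof (Rle_abs (y j)). lra.
Qed.

Definition collapse_carrier (y : Rpower collapse_index) : Prop :=
  exists p, collapse_domain p /\ y = collapse_eval p.

(** Domain points with values near [y] cluster at some [p] in [bX]. If [p] is in the domain,
    continuity gives [y = collapse_eval p]; otherwise [collapse_escape] forbids the clustering. *)
Lemma collapse_carrier_closed : is_closed collapse_carrier.
Proof.
  apply closed_of_closure. intros y Hy.
  destruct (cluster_nbhd y (fun V p => collapse_domain p /\ V (collapse_eval p)) (stone_cech_compact SC))
    as [p Hp].
  - intros V V' p S [Dp Vp]; auto.
  - intros V HV Vy. destruct (Hy V HV Vy) as [z [Vz [p [Dp ->]]]]; eauto.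
  - destruct (classic (collapse_domain p)) as [Dp|Np].
    + exists p; split; auto. apply functional_extensionality; intro j.
      apply eq_of_abs_small; intros eps He.
      destruct (collapse_eval_continuous p (fun z => Rabs (z j - collapse_eval p j) < eps / 2) Dp)
        as [W [HW [Wp SW]]].
      { exact (coordinate_continuous _ j _ (R_open_ball _ _)). }
      { rewrite Rminus_diag, Rabs_R0; lra. }
      destruct (Hp (fun z => Rabs (z j - y j) < eps / 2)) with (U := W) as [q [Wq [Dq Vq]]]; auto.
      { exact (coordinate_continuous _ j _ (R_open_ball _ _)). }
      { rewrite Rminus_diag, Rabs_R0; lra. }
      specialize (SW q Wq Dq).
      replace (y j - collapse_eval p j)
        with (- (collapse_eval q j - y j) + (collapse_eval q j - collapse_eval p j)) by ring.
      eapply Rle_lt_trans; [apply Rabs_triang|]. rewrite Rabs_Ropp. lra.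
    + destruct (collapse_escape p y Np) as [W [V [HW [Wp [HV [Vy D]]]]]].
      destruct (Hp V HV Vy W HW Wp) as [q [Wq [Dq Vq]]]. exfalso; eapply D; eauto.
Qed.

(** If [a] is not in [F], a Urysohn function that is 0 at [a] and 1 on [b] and [F] is constant on
    [F], hence a coordinate separating [a] from [b]. *)
Lemma collapse_eval_injective p q :
  collapse_eval p = collapse_eval q -> p = q \/ (F p /\ F q).
Proof.
  assert (G : forall a b, collapse_eval a = collapse_eval b -> a <> b -> F a).
  { intros a b E N. apply NNPP; intro Na.
    destruct (urysohn (fun z => z = a) (fun z => z = b \/ F z)) as [k [Ck [_ [Zk Ok]]]].
    - apply (stone_cech_compact SC).
    - apply (stone_cech_hausdorff SC).
    - apply closed_point, (stone_cech_hausdorff SC).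
    - apply closed_or; [apply closed_point, (stone_cech_hausdorff SC) | exact HF].
    - intros z -> [Q|Q]; auto.
    - destruct (collapse_index_of_continuous k Ck) as [j Hj].
      { intros u v Fu Fv. rewrite !Ok; auto. }
      pose proof (f_equal (fun y => y j) E) as Ej. cbn in Ej. rewrite !Hj, Zk, Ok in Ej; auto. lra. }
  intros E. destruct (classic (p = q)) as [|N]; [auto|]. right; split; eauto.
Qed.

Lemma collapse_eval_collapsed p q : F p -> F q -> collapse_eval p = collapse_eval q.
Proof.
  intros Fp Fq. apply functional_extensionality. intros [h [Ch Eh]]. cbn. auto.
Qed.

Lemma collapse_embedding : embedding (fun x => collapse_eval (e x)).
Proof.
  destruct (stone_cech_embedding SC) as [Ie [Ce Oe]]. split; [|split].
  - intros x x' E. apply Ie. destruct (collapse_eval_injective _ _ E) as [|[Q _]]; auto.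
    exfalso; apply (FX _ Q). exists x; auto.
  - intros V HV. apply open_local. intros x Vx.
    destruct (collapse_eval_continuous (e x) V) as [W [HW [Wx SW]]]; auto.
    { left; exists x; auto. }
    exists (fun x' => W (e x')). split; [apply Ce; auto|]. split; auto.
    intros x' Wx'. apply SW; auto. left; exists x'; auto.
  - intros U HU. destruct (Oe U HU) as [O [HO EO]].
    (* The union of the half-spaces [z j < 1] over coordinates [j] equal to 1 off [O]. Since [F]
       misses [X], Urysohn supplies one that vanishes at a given point of [X] in [O] and is constant
       on [F]. *)
    exists (fun y : Rpower collapse_index => exists V,
              (exists j : collapse_index, V = (fun z : Rpower collapse_index => z j < 1) /\
                 forall q, ~ O q -> collapse_eval q j = 1) /\ V y).
    split.
    + apply open_union. intros V [j [-> _]]. exact (coordinate_continuous _ j _ (R_open_lt 1)).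
    + intro x. rewrite EO. split.
      * intros Ox.
        destruct (urysohn (fun z => z = e x) (fun z => ~ O z \/ F z)) as [k [Ck [_ [Zk Ok]]]].
        -- apply (stone_cech_compact SC).
        -- apply (stone_cech_hausdorff SC).
        -- apply closed_point, (stone_cech_hausdorff SC).
        -- apply closed_or; [apply closed_compl, HO | exact HF].
        -- intros z -> [Q|Q]; auto. apply (FX _ Q). exists x; auto.
        -- destruct (collapse_index_of_continuous k Ck) as [j Hj].
           { intros u v Fu Fv. rewrite !Ok; auto. }
           exists (fun z => z j < 1). split.
           ++ exists j. split; auto. intros q Nq. rewrite Hj, Ok; auto.
           ++ rewrite Hj, Zk; auto; lra.
      * intros [V [[j [-> Hj]] L]]. apply NNPP; intro N. rewrite (Hj _ N) in L. lra.
Qed.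

Definition collapse_point (x : X) : subspace collapse_carrier :=
  exist _ (collapse_eval (e x))
    (ex_intro _ (e x) (conj (or_introl (ex_intro _ x eq_refl)) eq_refl)).

Lemma collapse_point_embedding : embedding collapse_point.
Proof.
  destruct collapse_embedding as [Ij [Cj Oj]]. split; [|split].
  - intros x x' E. apply Ij. exact (f_equal (fun z => proj1_sig z) E).
  - intros V [V' [HV' E]]. eapply open_ext; [exact (Cj V' HV')|]. intro x.
    rewrite E. reflexivity.
  - intros U HU. destruct (Oj U HU) as [V [HV E]].
    exists (fun z => V (proj1_sig z)). split; [exact (subspace_val_continuous _ V HV) | exact E].
Qed.

Lemma collapse_point_dense : dense (image collapse_point).
Proof.
  intros U [V [HV E]] [[y [p [Dp ->]]] Uy]. apply E in Uy. cbn in Uy.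
  destruct (collapse_eval_continuous p V Dp HV Uy) as [W [HW [Wp SW]]].
  destruct (trace_hit SC W p HW Wp) as [x Wx].
  exists (collapse_point x). split; [|exists x; auto]. apply E. cbn. apply SW; auto.
  left; exists x; auto.
Qed.

Definition collapse_ext : Ext X :=
  mkExt X (subspace collapse_carrier) collapse_point
    (subspace_power_tychonoff _ _) collapse_point_embedding collapse_point_dense.

Lemma collapse_point_eval p x : collapse_eval p = collapse_eval (e x) -> p = e x.
Proof.
  intros E. destruct (collapse_eval_injective _ _ E) as [|[_ Q]]; auto.
  exfalso; apply (FX _ Q). exists x; auto.
Qed.

Lemma collapse_ext_in_RX : in_RX collapse_ext.
Proof.
  split; [apply closed_subspace_power_realcompact, collapse_carrier_closed|].
  apply (compact_relation_image (fun p => cl_hewitt_remainder e p \/ F p)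
           (fun p (z : remainder collapse_ext) => proj1_sig (proj1_sig z) = collapse_eval p)
           (stone_cech_compact SC) remainder_part_closed).
  - intros p Cp.
    assert (Dp : collapse_domain p) by (right; exact Cp).
    set (t := exist _ (collapse_eval p) (ex_intro _ p (conj Dp eq_refl)) : subspace collapse_carrier).
    assert (Nt : ~ image (ext_emb collapse_ext) t).
    { intros [x E]. apply (f_equal (fun z => proj1_sig z)) in E. cbn in E.
      apply collapse_point_eval in E. subst p.
      destruct Cp as [Q|Q]; [apply (KX _ Q) | apply (FX _ Q)]; exists x; auto. }
    exists (exist _ t Nt). split; [reflexivity|].
    intros V [V1 [[V2 [HV2 E2]] E1]] Vt. apply E1, E2 in Vt. cbn in Vt.
    destruct (collapse_eval_continuous p V2 Dp HV2 Vt) as [W [HW [Wp SW]]].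
    exists W. repeat split; auto. intros q z Wq Cq Ez. apply E1, E2. rewrite Ez.
    apply SW; auto. right; exact Cq.
  - intros [[y [p [[[x ->]|Cp] ->]]] Nt].
    + exfalso; apply Nt. exists x. apply eq_sig_hprop; [intros; apply proof_irrelevance | reflexivity].
    + exists p; auto.
Qed.

Lemma collapse_tends p t :
  tends e (ext_emb collapse_ext) p t <-> collapse_domain p /\ proj1_sig t = collapse_eval p.
Proof.
  assert (G : forall (p : bX) (t : ext_space collapse_ext), collapse_domain p ->
              proj1_sig t = collapse_eval p -> tends e (ext_emb collapse_ext) p t).
  { intros q s Dq E V [V' [HV' E']] Vs. apply E' in Vs. rewrite E in Vs.
    destruct (collapse_eval_continuous q V' Dq HV' Vs) as [W [HW [Wq SW]]].
    exists W. repeat split; auto. intros x Wx. apply E'. cbn. apply SW; auto. left; exists x; auto. }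
  split; [|intros [Dp E]; auto]. intros H.
  destruct (classic (collapse_domain p)) as [Dp|Np].
  - split; auto.
    set (s := exist _ (collapse_eval p) (ex_intro _ p (conj Dp eq_refl)) : subspace collapse_carrier).
    rewrite (tends_unique SC (ext_emb collapse_ext) p t s); auto.
    apply ext_hausdorff.
  - exfalso. destruct (collapse_escape p (proj1_sig t) Np) as [W [V [HW [Wp [HV [Vt D]]]]]].
    destruct (H (fun z => V (proj1_sig z))) as [W' [HW' [Wp' S']]]; auto.
    { exact (subspace_val_continuous _ V HV). }
    destruct (trace_hit SC (fun q => W q /\ W' q) p) as [x [A B]]; auto using open_inter.
    apply (D (e x)); auto. { left; exists x; auto. } exact (S' x B).
Qed.

Lemma collapse_remainder_rel p q :
  remainder_rel e collapse_ext p q <->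
  (p = q /\ cl_hewitt_remainder e p) \/ (F p /\ F q).
Proof.
  split.
  - intros [Np [Nq [t [Hp Hq]]]].
    apply collapse_tends in Hp. apply collapse_tends in Hq.
    destruct Hp as [[Q|[Kp|Fp]] Ep]; [tauto| |].
    + destruct Hq as [Dq Eq]. rewrite Ep in Eq. destruct (collapse_eval_injective _ _ Eq); auto.
    + destruct Hq as [Dq Eq]. rewrite Ep in Eq.
      destruct (collapse_eval_injective _ _ Eq) as [<-|]; auto.
  - assert (G : forall a b, (cl_hewitt_remainder e a \/ F a) -> (cl_hewitt_remainder e b \/ F b) ->
                 collapse_eval a = collapse_eval b -> remainder_rel e collapse_ext a b).
    { intros a b Ha Hb E.
      split; [intro Q; destruct Ha as [H|H]; [exact (KX _ H Q) | exact (FX _ H Q)]|].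
      split; [intro Q; destruct Hb as [H|H]; [exact (KX _ H Q) | exact (FX _ H Q)]|].
      exists (exist _ (collapse_eval a) (ex_intro _ a (conj (or_intror Ha) eq_refl))).
      split; apply collapse_tends; cbn; split; auto; right; auto. }
    intros [[<- Kp]|[Fp Fq]]; apply G; auto. apply collapse_eval_collapsed; auto.
Qed.
End Collapse.

(** * Consequences of the two hypotheses on X for K *)

(** If K were empty, the collapse construction with [F] empty would give a closed copy of [X] itself
    in a power of R. *)
Lemma cl_hewitt_remainder_nonempty {X bX : Space} (e : X -> bX) :
  stone_cech X bX e -> ~ realcompact X -> exists p, cl_hewitt_remainder e p.
Proof.
  intros SC N. apply NNPP; intro M. apply N.
  set (F := fun _ : bX => False).
  assert (FX : forall p, F p -> ~ image e p) by (intros p []).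
  exists (@collapse_index X bX e F), (fun x => @collapse_eval X bX e F (e x)). split.
  - apply collapse_embedding; auto. apply closed_empty.
  - eapply open_ext; [exact (collapse_carrier_closed SC F closed_empty)|]. intro y.
    cut (@collapse_carrier X bX e F y <-> image (fun x => @collapse_eval X bX e F (e x)) y);
      [tauto|].
    split.
    + intros [p [[[x ->]|[Kp|[]]] ->]]; [exists x; auto | exfalso; eauto].
    + intros [x ->]. exists (e x). split; auto. left; exists x; auto.
Qed.

(* A function on the realcompact closed neighbourhood is multiplied by a cutoff so as to
   become a function on [X], to which the Hewitt extension property applies. *)
Lemma locally_realcompact_remainder {X bX : Space} (e : X -> bX) :
  stone_cech X bX e -> locally_realcompact X ->
  forall p, cl_hewitt_remainder e p -> ~ image e p.
Proof.
  intros SC HL p0 Hp0 [x0 ->].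
  destruct (HL x0) as [U [HU [Ux0 [I [i [Hi Hc]]]]]].
  destruct (stone_cech_embedding SC) as [Ie [Ce Oe]].
  destruct (Oe U HU) as [O [HO EO]].
  destruct (Hp0 O HO (proj1 (EO x0) Ux0)) as [p [Op [Hp Np]]].
  apply Np.
  set (z0 := exist _ x0 (closure_incl U x0 Ux0) : subspace (closure U)).
  (* [r] inverts the inclusion and takes the default [z0] off the closure, where the cutoff [k]
     vanishes and hides the default. *)
  assert (R : exists r : X -> subspace (closure U), forall x, closure U x -> proj1_sig (r x) = x).
  { apply (choice (fun x z => closure U x -> proj1_sig z = x)). intro x.
    destruct (classic (closure U x)) as [H|H]; [exists (exist _ x H); auto | exists z0; tauto]. }
  destruct R as [r Hr].
  destruct (urysohn (fun q => ~ O q) (fun q => q = p)) as [k [Ck [Bk [Zk Ok]]]].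
  { apply (stone_cech_compact SC). } { apply (stone_cech_hausdorff SC). }
  { apply closed_compl, HO. } { apply closed_point, (stone_cech_hausdorff SC). }
  { intros q Nq ->; auto. }
  assert (Kp : k p = 1) by auto.
  assert (Cke : continuous (fun x => k (e x))) by (intros V HV; exact (Ce _ (Ck V HV))).
  assert (Tk : flim (trace e p) (fun x => k (e x)) 1).
  { rewrite <- Kp. apply tends_flim, tends_extension; auto. }
  assert (Cf : forall j, continuous (fun x => i (r x) j * k (e x) : RSpace)).
  { intro j. apply cont_on_continuous. intros x _.
    assert (OU : forall y, ~ U y -> k (e y) = 0).
    { intros y Ny. apply Zk. rewrite <- EO. exact Ny. }
    destruct (classic (closure U x)) as [Zx|Nx].
    - assert (L : flim (nbhd (closure U) x) (fun y => i (r y) j * k (e y)) (i (r x) j * k (e x))).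
      { apply (flim_mult _ (nbhd_filter _ x)); [|exact (continuous_cont_on _ _ Cke x Zx)].
        intros eps He.
        assert (Ci : continuous (fun z => i z j : RSpace)).
        { intros V HV. exact (proj1 (proj2 Hi) _ (coordinate_continuous I j V HV)). }
        destruct (Ci _ (R_open_ball (i (r x) j) eps)) as [W [HW EW]].
        exists W. split; auto. split.
        - rewrite <- (Hr x Zx). apply EW. rewrite Rminus_diag, Rabs_R0; exact He.
        - intros y Wy Zy. apply EW. rewrite (Hr y Zy). exact Wy. }
      intros eps He. destruct (L eps He) as [W [HW [Wx SW]]].
      (* At a point of the closure outside [U] the product is 0, as it is off the closure, so the
         default value of [r] creates no jump. *)
      destruct (classic (U x)) as [Ux|NUx].
      + exists (fun y => W y /\ U y). split; [apply open_inter; auto|]. split; auto.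
        intros y [Wy Uy] _. apply SW; auto. apply closure_incl, Uy.
      + exists W. repeat split; auto. intros y Wy _.
        destruct (classic (closure U y)) as [Zy|NZy]; [auto|].
        rewrite (OU x NUx), (OU y). { rewrite !Rmult_0_r, Rminus_diag, Rabs_R0; exact He. }
        intro Uy; apply NZy, closure_incl, Uy.
    - intros eps He. exists (fun y => ~ closure U y). split; [apply closed_closure|]. split; auto.
      intros y Ny _. rewrite (OU x), (OU y).
      { rewrite !Rmult_0_r, Rminus_diag, Rabs_R0; exact He. }
      { intro Uy; apply Ny, closure_incl, Uy. } { intro Uy; apply Nx, closure_incl, Uy. } }
  destruct (tends_power_coordinates SC I i r p Hi Hc) as [t Ht].
  { intro j. destruct (hewitt_tends p _ Hp (Cf j)) as [y Hy]. apply tends_flim in Hy.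
    (* The limit of the product is divided by the limit 1 of the cutoff, which is positive near [p]
       and cancels. *)
    exists (y * / 1). apply tends_flim. intros eps He.
    pose proof (flim_mult _ (trace_filter e p) _ _ _ _ Hy
                  (flim_inv _ (trace_filter e p) _ _ R1_neq_R0 Tk)) as L.
    eapply (filter_mono _ (trace_filter e p));
      [|exact (filter_inter _ (trace_filter e p) _ _ (L eps He) (Tk 1 Rlt_0_1))].
    intros x [A B]. cbn beta in A, B. apply Rabs_def2 in B.
    rewrite Rmult_assoc, Rinv_r, Rmult_1_r in A by lra. exact A. }
  exists (proj1_sig t). apply NNPP; intro N.
  destruct (stone_cech_hausdorff SC p (e (proj1_sig t)) N) as [U1 [V1 [HU1 [HV1 [U1p [V1t D]]]]]].
  destruct (Ht (fun z => V1 (e (proj1_sig z)))) as [W [HW [Wp SW]]]; auto.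
  { exact (subspace_val_continuous _ _ (Ce V1 HV1)). }
  destruct (trace_hit SC (fun q => (U1 q /\ W q) /\ O q) p) as [x [[A B] Ox]];
    auto using open_inter.
  apply (D (e x)); auto. specialize (SW x B). cbn in SW.
  rewrite Hr in SW; auto. apply closure_incl, EO, Ox.
Qed.

(** * Pairs and points from the order *)

Definition rel_incl {B : Type} (S T : B -> B -> Prop) : Prop := forall p q, S p q -> T p q.

Definition collapsed {B : Type} (K F : B -> Prop) (p q : B) : Prop :=
  (p = q /\ K p) \/ (F p /\ F q).

(** What the order argument uses about R(X). In [family_collapsed] the demand that each point of [F]
    lie in some domain stands for being outside [X], which is not mentioned here. *)
Record collapse_family {B : Space} (K : B -> Prop) (P : (B -> B -> Prop) -> Prop) : Prop := {
  family_hausdorff : hausdorff B;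
  family_base : exists k, K k;
  family_sym : forall S p q, P S -> S p q -> S q p;
  family_trans : forall S p q r, P S -> S p q -> S q r -> S p r;
  family_domain : forall S p, P S -> K p -> S p p;
  family_class_closed : forall S p, P S -> S p p -> is_closed (fun q => S p q);
  family_collapsed : forall F : B -> Prop, is_closed F ->
    (forall p, F p -> exists S, P S /\ S p p) -> P (collapsed K F)
}.

(** Inclusion reverses the order of R(X): the least relation, the identity on [K], belongs to the
    greatest extension, and atoms to the extensions immediately below it. *)
Definition bottom {B : Type} (P : (B -> B -> Prop) -> Prop) (S : B -> B -> Prop) : Prop :=
  forall T, P T -> rel_incl S T.

Definition atom {B : Type} (P : (B -> B -> Prop) -> Prop) (S : B -> B -> Prop) : Prop :=
  P S /\ ~ bottom P S /\ forall T, P T -> rel_incl T S -> bottom P T \/ rel_incl S T.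

(* Singles out the atoms that identify two points of [K] from those that enlarge the
   domain by a point [p]: gluing such a [p] to [K] creates no new atom. *)
Definition pair_atom {B : Type} (P : (B -> B -> Prop) -> Prop) (S : B -> B -> Prop) : Prop :=
  atom P S /\ forall T, P T -> rel_incl S T ->
    rel_incl T S \/ exists Z, atom P Z /\ rel_incl Z T /\ ~ rel_incl Z S.

Lemma closed_list {B : Space} (l : list B) : hausdorff B -> is_closed (fun x => In x l).
Proof.
  intros H2. induction l as [|a l IH]; [apply closed_empty|].
  eapply open_ext; [exact (closed_or _ _ (closed_point a H2) IH)|].
  intro x; cbn. split; intros N [E|I]; apply N; auto.
Qed.

Section Family.
Context {B : Space} {K : B -> Prop} {P : (B -> B -> Prop) -> Prop} (HP : collapse_family K P).

Definition glue (l : list B) : B -> B -> Prop := collapsed K (fun x => In x l).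

Lemma family_glue l : (forall p, In p l -> exists S, P S /\ S p p) -> P (glue l).
Proof.
  intros H. apply (family_collapsed K P HP); auto.
  apply closed_list, (family_hausdorff K P HP).
Qed.

Lemma family_glue_base l : (forall p, In p l -> K p) -> P (glue l).
Proof.
  intros H. apply family_glue. intros p Hp.
  assert (P0 : P (glue nil)) by (apply family_glue; intros q []).
  exists (glue nil). split; auto. apply (family_domain K P HP); auto.
Qed.

Lemma family_refl_l S p q : P S -> S p q -> S p p.
Proof.
  intros HS H. apply (family_trans K P HP S p q p HS H). apply (family_sym K P HP); auto.
Qed.

Lemma collapsed_incl (F : B -> Prop) S :
  P S -> (forall x y, F x -> F y -> S x y) -> rel_incl (collapsed K F) S.
Proof.
  intros HS H x y [[<- Kx]|[Fx Fy]]; auto. apply (family_domain K P HP); auto.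
Qed.

Lemma glue_pair_incl a b S : P S -> S a b -> rel_incl (glue (a :: b :: nil)) S.
Proof.
  intros HS H. apply collapsed_incl; auto.
  pose proof (family_sym K P HP S a b HS H) as H'.
  pose proof (family_refl_l S a b HS H). pose proof (family_refl_l S b a HS H').
  cbn. intros x y [<-|[<-|[]]] [<-|[<-|[]]]; auto.
Qed.

Lemma bottom_spec S : P S -> (bottom P S <-> forall p q, S p q -> p = q /\ K p).
Proof.
  intros HS; split.
  - intros H p q Spq.
    assert (P0 : P (glue nil)) by (apply family_glue; intros x []).
    destruct (H _ P0 p q Spq) as [E|[[] _]]; exact E.
  - intros H T HT p q Spq. destruct (H p q Spq) as [<- Kp]. apply (family_domain K P HP); auto.
Qed.

Lemma not_bottom S : P S -> ~ bottom P S -> exists p q, S p q /\ ~ (p = q /\ K p).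
Proof.
  intros HS N. apply NNPP; intro M. apply N. apply (bottom_spec S HS).
  intros p q H. apply NNPP; intro Q. apply M; eauto.
Qed.

Lemma glue_pair_atom_incl a b T :
  K a -> K b -> P T -> rel_incl T (glue (a :: b :: nil)) ->
  bottom P T \/ rel_incl (glue (a :: b :: nil)) T.
Proof.
  intros Ka Kb HT I. destruct (classic (T a b)) as [H|H].
  - right. apply glue_pair_incl; auto.
  - left. apply bottom_spec; auto. intros p q Tpq.
    destruct (I p q Tpq) as [E|[Hp Hq]]; auto. cbn in Hp, Hq.
    destruct Hp as [<-|[<-|[]]], Hq as [<-|[<-|[]]]; auto; try tauto.
    exfalso; apply H, (family_sym K P HP); auto.
Qed.

Lemma glue_pair_atom a b : K a -> K b -> a <> b -> atom P (glue (a :: b :: nil)).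
Proof.
  intros Ka Kb N.
  assert (HE : P (glue (a :: b :: nil))).
  { apply family_glue_base. intros p [<-|[<-|[]]]; auto. }
  repeat split; auto.
  - intros H0. pose proof (proj1 (bottom_spec _ HE) H0) as H.
    destruct (H a b) as [E _]; auto. right; cbn; auto.
  - intros T HT I. apply glue_pair_atom_incl; auto.
Qed.

Lemma glue_point_atom p S : ~ K p -> P S -> S p p -> atom P (glue (p :: nil)).
Proof.
  intros N HS Hp.
  assert (HE : P (glue (p :: nil))).
  { apply family_glue. intros q [<-|[]]; eauto. }
  repeat split; auto.
  - intros H0. pose proof (proj1 (bottom_spec _ HE) H0) as H.
    destruct (H p p) as [_ E]; auto. right; cbn; auto.
  - intros T HT I. destruct (classic (T p p)) as [Tp|NT].
    + right. apply collapsed_incl; auto. intros x y [<-|[]] [<-|[]]; auto.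
    + left. apply bottom_spec; auto. intros x y Txy.
      destruct (I x y Txy) as [E|[[<-|[]] [<-|[]]]]; auto. contradiction.
Qed.

Lemma atom_eq S Z : atom P S -> atom P Z -> rel_incl Z S -> rel_incl S Z.
Proof.
  intros [_ [_ H]] [HZ [NZ _]] I. destruct (H Z HZ I); auto. contradiction.
Qed.

Lemma pair_atom_glue a b : K a -> K b -> a <> b -> pair_atom P (glue (a :: b :: nil)).
Proof.
  intros Ka Kb N. split; [apply glue_pair_atom; auto|]. intros T HT I.
  destruct (classic (rel_incl T (glue (a :: b :: nil)))) as [|M]; auto. right.
  assert (Q : exists x y, T x y /\ ~ glue (a :: b :: nil) x y).
  { apply NNPP; intro Q. apply M. intros x y Txy. apply NNPP; intro W. apply Q; eauto. }
  destruct Q as [x [y [Txy Nxy]]].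
  assert (G : forall z, T z z -> ~ K z -> exists Z, atom P Z /\ rel_incl Z T /\
                                     ~ rel_incl Z (glue (a :: b :: nil))).
  { intros z Tz Nz. exists (glue (z :: nil)). split; [apply (glue_point_atom z T); auto|]. split.
    - apply collapsed_incl; auto. intros u v [<-|[]] [<-|[]]; auto.
    - intros J. destruct (J z z) as [[_ Kz]|[[<-|[<-|[]]] _]]; auto. right; cbn; auto. }
  pose proof (family_sym K P HP T x y HT Txy) as Tyx.
  destruct (classic (K x)) as [Kx|Nx]; [|apply (G x); auto; apply (family_refl_l T x y); auto].
  destruct (classic (K y)) as [Ky|Ny]; [|apply (G y); auto; apply (family_refl_l T y x); auto].
  assert (Exy : x <> y) by (intros <-; apply Nxy; left; auto).
  exists (glue (x :: y :: nil)). split; [apply glue_pair_atom; auto|].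
  split; [apply glue_pair_incl; auto|]. intros J. apply Nxy, J. right; cbn; auto.
Qed.

Lemma pair_atom_spec S : pair_atom P S ->
  exists a b, K a /\ K b /\ a <> b /\ rel_incl S (glue (a :: b :: nil)) /\
         rel_incl (glue (a :: b :: nil)) S.
Proof.
  intros [HA H]. pose proof HA as [HS [NB Hmin]].
  assert (G : forall x, S x x -> K x).
  { intros x Sx. apply NNPP; intro Nx.
    pose proof (glue_point_atom x S Nx HS Sx) as Ax.
    assert (I1 : rel_incl (glue (x :: nil)) S)
      by (apply collapsed_incl; auto; intros u v [<-|[]] [<-|[]]; auto).
    pose proof (atom_eq _ _ HA Ax I1) as I2.
    destruct (family_base K P HP) as [k Kk].
    assert (HT : P (glue (x :: k :: nil))).
    { apply family_glue. intros p [<-|[<-|[]]]; [eauto|].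
      exists S; split; auto. apply (family_domain K P HP); auto. }
    destruct (H _ HT) as [J|[Z [AZ [ZT ZS]]]].
    - intros u v Suv. destruct (I2 u v Suv) as [E|[[<-|[]] [<-|[]]]]; [left; auto|].
      right; cbn; auto.
    - assert (Sxk : S x k) by (apply J; right; cbn; auto).
      destruct (I2 x k Sxk) as [[<- _]|[_ [<-|[]]]]; auto.
    - apply ZS.
      (* A nontrivial pair of [Z] lies in the class of [x] and [k] and is not [k] with itself, so it
         involves [x]. Hence [Z] contains the atom of [x], equals it, and lies in [S]. *)
      destruct (not_bottom Z (proj1 AZ) (proj1 (proj2 AZ))) as [u [v [Zuv Nuv]]].
      assert (Zx : Z x x).
      { pose proof (family_sym K P HP Z u v (proj1 AZ) Zuv) as Zvu.
        destruct (ZT u v Zuv) as [E|[Hu Hv]]; [contradiction|]. cbn in Hu, Hv.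
        destruct Hu as [<-|[<-|[]]]; [apply (family_refl_l Z x v (proj1 AZ)); auto|].
        destruct Hv as [<-|[<-|[]]]; [apply (family_refl_l Z x k (proj1 AZ)); auto|].
        exfalso; apply Nuv; auto. }
      assert (I3 : rel_incl (glue (x :: nil)) Z)
        by (apply collapsed_incl; [apply AZ | intros a b [<-|[]] [<-|[]]; auto]).
      intros a b Zab. apply I1. apply (atom_eq _ _ AZ Ax I3). exact Zab. }
  destruct (not_bottom S HS NB) as [x [y [Sxy Nxy]]].
  pose proof (family_sym K P HP S x y HS Sxy) as Syx.
  assert (Kx : K x) by (apply G, (family_refl_l S x y); auto).
  assert (Ky : K y) by (apply G, (family_refl_l S y x); auto).
  assert (N : x <> y) by (intros <-; apply Nxy; auto).
  assert (I : rel_incl (glue (x :: y :: nil)) S) by (apply glue_pair_incl; auto).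
  exists x, y. repeat split; auto. apply atom_eq; auto. apply glue_pair_atom; auto.
Qed.

Lemma glue_base_pair l a b : a <> b -> glue l a b -> In a l /\ In b l.
Proof. intros N [[E _]|H]; [contradiction | exact H]. Qed.
End Family.
Arguments glue {B} K l.

(** * Transport of pairs along an order correspondence *)

(** A relation rather than a map, because the isomorphism acts on representatives; being symmetric
    in the two sides, it yields each converse by flipping. *)
Record order_correspondence {B B' : Type}
  (P : (B -> B -> Prop) -> Prop) (P' : (B' -> B' -> Prop) -> Prop)
  (Th : (B -> B -> Prop) -> (B' -> B' -> Prop) -> Prop) : Prop := {
  corr_left : forall S S', Th S S' -> P S;
  corr_right : forall S S', Th S S' -> P' S';
  corr_total : forall S, P S -> exists S', Th S S';
  corr_surj : forall S', P' S' -> exists S, Th S S';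
  corr_incl : forall S S' T T', Th S S' -> Th T T' -> (rel_incl S T <-> rel_incl S' T')
}.

Lemma order_correspondence_flip {B B' : Type} (P : (B -> B -> Prop) -> Prop)
  (P' : (B' -> B' -> Prop) -> Prop) Th :
  order_correspondence P P' Th -> order_correspondence P' P (fun S' S => Th S S').
Proof.
  intros [A1 A2 A3 A4 A5]. split; eauto. intros S S' T T' H1 H2.
  symmetry; apply A5; auto.
Qed.

Lemma bottom_transfer {B B' : Type} {P : (B -> B -> Prop) -> Prop}
  {P' : (B' -> B' -> Prop) -> Prop} {Th : (B -> B -> Prop) -> (B' -> B' -> Prop) -> Prop} :
  order_correspondence P P' Th ->
  forall S S', Th S S' -> bottom P S -> bottom P' S'.
Proof.
  intros HT S S' H HB T' HT'. destruct (corr_surj _ _ _ HT T' HT') as [T Ht].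
  apply (corr_incl _ _ _ HT S S' T T'); auto. apply HB, (corr_left _ _ _ HT T T'); auto.
Qed.

Lemma atom_transfer {B B' : Type} {P : (B -> B -> Prop) -> Prop} {P' : (B' -> B' -> Prop) -> Prop}
  {Th : (B -> B -> Prop) -> (B' -> B' -> Prop) -> Prop} :
  order_correspondence P P' Th ->
  forall S S', Th S S' -> atom P S -> atom P' S'.
Proof.
  intros HT S S' H [HS [NB Hm]]. split; [|split].
  - apply (corr_right _ _ _ HT S S' H).
  - intro Q. apply NB. apply (bottom_transfer (order_correspondence_flip _ _ _ HT) S' S H Q).
  - intros T' HT' I. destruct (corr_surj _ _ _ HT T' HT') as [T Ht].
    destruct (Hm T (corr_left _ _ _ HT T T' Ht)) as [Q|Q].
    + apply (corr_incl _ _ _ HT T T' S S'); auto.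
    + left. apply (bottom_transfer HT T T' Ht Q).
    + right. apply (corr_incl _ _ _ HT S S' T T'); auto.
Qed.

Lemma pair_atom_transfer {B B' : Type} {P : (B -> B -> Prop) -> Prop}
  {P' : (B' -> B' -> Prop) -> Prop} {Th : (B -> B -> Prop) -> (B' -> B' -> Prop) -> Prop} :
  order_correspondence P P' Th ->
  forall S S', Th S S' -> pair_atom P S -> pair_atom P' S'.
Proof.
  intros HT S S' H [HA Hm]. split; [exact (atom_transfer HT S S' H HA)|].
  intros T' HT' I. destruct (corr_surj _ _ _ HT T' HT') as [T Ht].
  destruct (Hm T (corr_left _ _ _ HT T T' Ht)) as [Q|[Z [AZ [ZT ZS]]]].
  - apply (corr_incl _ _ _ HT S S' T T'); auto.
  - left. apply (corr_incl _ _ _ HT T T' S S'); auto.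
  - right. destruct (corr_total _ _ _ HT Z (proj1 AZ)) as [Z' Hz]. exists Z'.
    split; [exact (atom_transfer HT Z Z' Hz AZ)|]. split.
    + apply (corr_incl _ _ _ HT Z Z' T T'); auto.
    + intro Q. apply ZS. apply (corr_incl _ _ _ HT Z Z' S S'); auto.
Qed.

(** Quantifying over all corresponding relations, not just the two atoms, lets transitivity be
    applied on either side. The pairs are in effect unordered, as the swap lemmas show. *)
Record pair_match {B B' : Type} (K : B -> Prop) (L : B' -> Prop)
  (Th : (B -> B -> Prop) -> (B' -> B' -> Prop) -> Prop) (a b : B) (u v : B') : Prop := {
  match_l1 : K a;
  match_l2 : K b;
  match_l : a <> b;
  match_r1 : L u;
  match_r2 : L v;
  match_r : u <> v;
  match_iff : forall S S', Th S S' -> (S a b <-> S' u v)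
}.

Lemma pair_match_flip {B B' : Type} (K : B -> Prop) (L : B' -> Prop) Th a b u v :
  pair_match K L Th a b u v -> pair_match L K (fun S' S => Th S S') u v a b.
Proof. intros []; split; auto. intros S S' H. symmetry; auto. Qed.

Section Matching.
Context {B B' : Space} {K : B -> Prop} {L : B' -> Prop}.
Context {P : (B -> B -> Prop) -> Prop} {P' : (B' -> B' -> Prop) -> Prop}.
Context {Th : (B -> B -> Prop) -> (B' -> B' -> Prop) -> Prop}.
Context (HP : collapse_family K P) (HP' : collapse_family L P').
Context (HT : order_correspondence P P' Th).
Let M := pair_match K L Th.

(** A relation identifies [a] and [b] exactly when it contains their pair atom, and the partner of
    that atom is again the atom of a pair. *)
Lemma pair_match_exists a b : K a -> K b -> a <> b -> exists u v, M a b u v.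
Proof.
  intros Ka Kb N. pose proof (pair_atom_glue HP a b Ka Kb N) as HA.
  destruct (corr_total _ _ _ HT _ (proj1 (proj1 HA))) as [S' HS'].
  pose proof (pair_atom_transfer HT _ _ HS' HA) as HA'.
  destruct (pair_atom_spec HP' S' HA') as [u [v [Lu [Lv [N' [I1 I2]]]]]].
  exists u, v. split; auto. intros T T' Ht.
  pose proof (corr_incl _ _ _ HT _ _ _ _ HS' Ht) as E.
  pose proof (corr_left _ _ _ HT _ _ Ht). pose proof (corr_right _ _ _ HT _ _ Ht).
  split.
  - intros Tab. apply E; [apply (glue_pair_incl HP); auto|]. apply I2. right; cbn; auto.
  - intros Tuv. apply E; [|right; cbn; auto].
    intros p q Hpq. apply (glue_pair_incl HP' u v T'); auto.
Qed.

Lemma pair_match_swap_l a b u v : M a b u v -> M b a u v.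
Proof.
  intros []; split; auto. intros S S' H. rewrite <- (match_iff0 S S' H).
  pose proof (corr_left _ _ _ HT S S' H).
  split; apply (family_sym K P HP); auto.
Qed.

Lemma pair_match_swap_r a b u v : M a b u v -> M a b v u.
Proof.
  intros []; split; auto. intros S S' H. rewrite (match_iff0 S S' H).
  pose proof (corr_right _ _ _ HT S S' H).
  split; apply (family_sym L P' HP'); auto.
Qed.

(* Reads off [glue L l] on both sides: what [P] forces on the left stays inside [l]. *)
Lemma pair_match_forced l a b u v :
  (forall w, In w l -> L w) ->
  (forall S, P S -> (forall c d s t, M c d s t -> In s l -> In t l -> S c d) -> S a b) ->
  M a b u v -> In u l /\ In v l.
Proof.
  intros Hl H Hm.
  pose proof (family_glue_base HP' l Hl) as HE.
  destruct (corr_surj _ _ _ HT _ HE) as [S HS].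
  apply (glue_base_pair (K := L)); [apply Hm|].
  apply (match_iff _ _ _ _ _ _ _ Hm S _ HS). apply H.
  - exact (corr_left _ _ _ HT _ _ HS).
  - intros c d s t Hc Is It. apply (match_iff _ _ _ _ _ _ _ Hc S _ HS). right; auto.
Qed.

Lemma pair_match_unique_r a b u v u' v' :
  M a b u v -> M a b u' v' -> (u' = u /\ v' = v) \/ (u' = v /\ v' = u).
Proof.
  intros H H'. pose proof (match_r _ _ _ _ _ _ _ H') as N.
  destruct (pair_match_forced (u :: v :: nil) a b u' v') as [A C]; auto.
  - intros w [<-|[<-|[]]]; apply H.
  - intros S HS G. apply (G a b u v); cbn; auto.
  - cbn in A, C. destruct A as [<-|[<-|[]]], C as [<-|[<-|[]]]; auto; congruence.
Qed.
End Matching.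

(** * From pairs to points *)

Section Bijection.
Context {B B' : Space} {K : B -> Prop} {L : B' -> Prop}.
Context {P : (B -> B -> Prop) -> Prop} {P' : (B' -> B' -> Prop) -> Prop}.
Context {Th : (B -> B -> Prop) -> (B' -> B' -> Prop) -> Prop}.
Context (HP : collapse_family K P) (HP' : collapse_family L P').
Context (HT : order_correspondence P P' Th).
Let M := pair_match K L Th.

Lemma pair_match_unique_l a b a' b' u v :
  M a b u v -> M a' b' u v -> (a' = a /\ b' = b) \/ (a' = b /\ b' = a).
Proof.
  intros H H'.
  exact (pair_match_unique_r HP (order_correspondence_flip _ _ _ HT) u v a b a' b'
           (pair_match_flip _ _ _ _ _ _ _ H) (pair_match_flip _ _ _ _ _ _ _ H')).
Qed.

(** By transitivity the image of [a c] lies in [{u, v, s, t}]; by injectivity on pairs it is neither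
    [{u, v}] nor [{s, t}], so it meets both. Gluing [s], [t] and its endpoint in [{u, v}] then
    identifies [a], [b] and [c], forcing both [u] and [v] into this glued set, which contains only
    one of them. *)
Lemma pair_match_disjoint_false a b c u v s t :
  a <> c -> M a b u v -> M b c s t -> u <> s -> u <> t -> v <> s -> v <> t -> False.
Proof.
  intros Nac H1 H2 N1 N2 N3 N4.
  destruct (pair_match_exists HP HP' HT a c) as [k [l H3]]; auto; [apply H1 | apply H2 |].
  assert (G : forall k l, M a c k l -> (k = u \/ k = v) -> (l = s \/ l = t) -> False).
  { clear k l H3. intros k l H3 Hk Hl.
    destruct (pair_match_forced (K := K) HP' HT (k :: s :: t :: nil) a b u v) as [A C]; auto.
    - intros w [<-|[<-|[<-|[]]]]; [apply H3 | apply H2 | apply H2].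
    - intros S HS Q. apply (family_trans K P HP S a c b HS).
      + apply (Q a c k l H3); cbn; tauto || (destruct Hl as [->| ->]; auto).
      + apply (family_sym K P HP S b c HS). apply (Q b c s t H2); cbn; auto.
    - pose proof (match_r _ _ _ _ _ _ _ H1). cbn in A, C.
      destruct A as [A|[A|[A|[]]]], C as [C|[C|[C|[]]]]; congruence. }
  destruct (pair_match_forced (K := K) HP' HT (u :: v :: s :: t :: nil) a c k l) as [A C]; auto.
  - intros w [<-|[<-|[<-|[<-|[]]]]]; first [apply H1 | apply H2].
  - intros S HS Q. apply (family_trans K P HP S a b c HS).
    + apply (Q a b u v H1); cbn; auto.
    + apply (Q b c s t H2); cbn; auto.
  - assert (E : forall k l, M a c k l -> k = u -> l = v -> False).
    { intros k' l' H -> ->.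
      pose proof (match_l _ _ _ _ _ _ _ H1). pose proof (match_l _ _ _ _ _ _ _ H2).
      destruct (pair_match_unique_l a b a c u v H1 H) as [[? ?]|[? ?]]; congruence. }
    assert (E' : forall k l, M a c k l -> k = s -> l = t -> False).
    { intros k' l' H -> ->.
      pose proof (match_l _ _ _ _ _ _ _ H1). pose proof (match_l _ _ _ _ _ _ _ H2).
      destruct (pair_match_unique_l b c a c s t H2 H) as [[? ?]|[? ?]]; congruence. }
    pose proof (pair_match_swap_r HP' HT _ _ _ _ H3) as H3'.
    pose proof (match_r _ _ _ _ _ _ _ H3). cbn in A, C.
    destruct A as [A|[A|[A|[A|[]]]]], C as [C|[C|[C|[C|[]]]]]; subst; try congruence;
      solve [ eapply (G _ _ H3); auto | eapply (G _ _ H3'); auto | eapply (E _ _ H3); auto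
            | eapply (E _ _ H3'); auto | eapply (E' _ _ H3); auto | eapply (E' _ _ H3'); auto ].
Qed.

(** Two adjacent edges have images sharing a vertex [v]. Transitivity confines the third image to
    the three endpoints, and injectivity makes it the edge opposite [v]: a triangle, not a star. *)
Lemma pair_match_triangle a b c : K a -> K b -> K c -> a <> b -> b <> c -> a <> c ->
  exists x y z, M a b x y /\ M b c y z /\ M a c x z.
Proof.
  intros Ka Kb Kc Nab Nbc Nac.
  destruct (pair_match_exists HP HP' HT a b) as [u [v H1]]; auto.
  destruct (pair_match_exists HP HP' HT b c) as [s [t H2]]; auto.
  destruct (pair_match_exists HP HP' HT a c) as [k [l H3]]; auto.
  assert (G : forall u v t, M a b u v -> M b c v t -> exists x y z, M a b x y /\ M b c y z /\ M a c x z).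
  { clear u v s t H1 H2. intros u v t H1 H2. exists u, v, t. split; [auto|]. split; [auto|].
    pose proof (match_r _ _ _ _ _ _ _ H1) as Nuv. pose proof (match_r _ _ _ _ _ _ _ H2) as Nvt.
    pose proof (match_r _ _ _ _ _ _ _ H3) as Nkl.
    destruct (pair_match_forced (K := K) HP' HT (u :: v :: t :: nil) a c k l) as [A C]; auto.
    { intros w [<-|[<-|[<-|[]]]]; first [apply H1 | apply H2]. }
    { intros S HS Q. apply (family_trans K P HP S a b c HS).
      - apply (Q a b u v H1); cbn; auto.
      - apply (Q b c v t H2); cbn; auto. }
    assert (E : forall k l, M a c k l -> k = u -> l = v -> False).
    { intros k' l' H -> ->.
      destruct (pair_match_unique_l a b a c u v H1 H) as [[? ?]|[? ?]]; congruence. }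
    assert (E' : forall k l, M a c k l -> k = v -> l = t -> False).
    { intros k' l' H -> ->.
      destruct (pair_match_unique_l b c a c v t H2 H) as [[? ?]|[? ?]]; congruence. }
    pose proof (pair_match_swap_r HP' HT _ _ _ _ H3) as H3'. cbn in A, C.
    destruct A as [A|[A|[A|[]]]], C as [C|[C|[C|[]]]]; subst; try congruence; auto; exfalso;
      solve [ eapply (E _ _ H3); auto | eapply (E _ _ H3'); auto
            | eapply (E' _ _ H3); auto | eapply (E' _ _ H3'); auto ]. }
  pose proof (pair_match_swap_r HP' HT _ _ _ _ H1) as H1'.
  pose proof (pair_match_swap_r HP' HT _ _ _ _ H2) as H2'.
  destruct (classic (v = s)) as [<-|N3]; [eauto|].
  destruct (classic (v = t)) as [<-|N4]; [eauto|].
  destruct (classic (u = s)) as [<-|N1]; [eauto|].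
  destruct (classic (u = t)) as [<-|N2]; [eauto|].
  exfalso. eapply pair_match_disjoint_false; eauto.
Qed.

(* [x] is the common vertex of the images of the edges at [a]. *)
Definition vertex_match (a : B) (x : B') : Prop :=
  K a /\ L x /\ forall d, K d -> d <> a -> exists w, M a d x w.

Lemma vertex_match_exists a b c : K a -> K b -> K c -> a <> b -> b <> c -> a <> c ->
  exists x, vertex_match a x.
Proof.
  intros Ka Kb Kc Nab Nbc Nac.
  destruct (pair_match_triangle a b c Ka Kb Kc Nab Nbc Nac) as [x [y [z [H1 [H2 H3]]]]].
  exists x. split; auto. split; [apply H1|]. intros d Kd Nd.
  destruct (classic (d = b)) as [->|Ndb]; [eauto|].
  destruct (classic (d = c)) as [->|Ndc]; [eauto|].
  (* If the image of [a d] avoided [x], it would meet the images of [a b] and [a c] in [y] and [z].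
     It would then be [{y, z}], the image of [b c]. *)
  destruct (pair_match_triangle b a d) as [p [q [r [T1 [T2 T3]]]]]; auto.
  destruct (pair_match_triangle c a d) as [p' [q' [r' [T1' [T2' T3']]]]]; auto.
  apply (pair_match_swap_l HP HT) in T1. apply (pair_match_swap_l HP HT) in T1'.
  destruct (pair_match_unique_r HP' HT _ _ _ _ _ _ H1 T1) as [[-> ->]|[-> ->]]; [|eauto].
  destruct (pair_match_unique_r HP' HT _ _ _ _ _ _ H3 T1') as [[-> ->]|[-> ->]]; [|eauto].
  exfalso. pose proof (match_r _ _ _ _ _ _ _ H2).
  destruct (pair_match_unique_r HP' HT _ _ _ _ _ _ T2 T2') as [[E1 E2]|[E1 E2]]; [congruence|].
  subst. destruct (pair_match_unique_l _ _ _ _ _ _ H2 T2) as [[? ?]|[? ?]]; congruence.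
Qed.

Lemma vertex_match_unique a b c x x' : K b -> K c -> a <> b -> b <> c -> a <> c ->
  vertex_match a x -> vertex_match a x' -> x = x'.
Proof.
  intros Kb Kc Nab Nbc Nac [Ka [Lx H]] [_ [Lx' H']]. apply NNPP; intro N.
  assert (G : forall d, K d -> d <> a -> M a d x x').
  { intros d Kd Nd. destruct (H d Kd Nd) as [w Hw]. destruct (H' d Kd Nd) as [w' Hw'].
    destruct (pair_match_unique_r HP' HT _ _ _ _ _ _ Hw Hw') as [[E1 E2]|[E1 E2]]; congruence. }
  assert (Gb : M a b x x') by auto. assert (Gc : M a c x x') by auto.
  destruct (pair_match_unique_l _ _ _ _ _ _ Gb Gc) as [[? ?]|[? ?]]; congruence.
Qed.

Lemma vertex_match_pair a b c x y : K c -> a <> b -> b <> c -> a <> c ->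
  vertex_match a x -> vertex_match b y -> M a b x y.
Proof.
  intros Kc Nab Nbc Nac [Ka [Lx Ha]] [Kb [Ly Hb]].
  destruct (Ha b Kb) as [w Hw]; auto. destruct (Hb a Ka) as [w' Hw']; auto.
  apply (pair_match_swap_l HP HT) in Hw'.
  (* In the bad case [a] and [b] have the same vertex, which then lies on all three images of the
     edges of [a b c]; this is the star excluded by [pair_match_triangle]. *)
  destruct (pair_match_unique_r HP' HT _ _ _ _ _ _ Hw Hw') as [[-> ->]|[-> ->]]; [exfalso|auto].
  destruct (Ha c Kc) as [m Hm]; auto. destruct (Hb c Kc) as [n Hn]; auto.
  destruct (pair_match_triangle a b c) as [p [q [r [T1 [T2 T3]]]]]; auto.
  pose proof (match_r _ _ _ _ _ _ _ T1). pose proof (match_r _ _ _ _ _ _ _ T2).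
  pose proof (match_r _ _ _ _ _ _ _ T3).
  destruct (pair_match_unique_r HP' HT _ _ _ _ _ _ T1 Hw) as [[? ?]|[? ?]];
  destruct (pair_match_unique_r HP' HT _ _ _ _ _ _ T2 Hn) as [[? ?]|[? ?]];
  destruct (pair_match_unique_r HP' HT _ _ _ _ _ _ T3 Hm) as [[? ?]|[? ?]]; congruence.
Qed.

Lemma pair_match_surj u v : L u -> L v -> u <> v -> exists a b, M a b u v.
Proof.
  intros Lu Lv N.
  destruct (pair_match_exists HP' HP (order_correspondence_flip _ _ _ HT) u v Lu Lv N)
    as [a [b H]].
  exists a, b. exact (pair_match_flip _ _ _ _ _ _ _ H).
Qed.

(** Kept separate from [vertex_match], which is not single-valued when [K] has two points. *)
Record vertex_bijection (G : B -> B' -> Prop) : Prop := {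
  vb_dom : forall a x, G a x -> K a /\ L x;
  vb_total : forall a, K a -> exists x, G a x;
  vb_surj : forall x, L x -> exists a, G a x;
  vb_fun : forall a x x', G a x -> G a x' -> x = x';
  vb_match : forall a b x y, G a x -> G b y -> a <> b -> M a b x y
}.

Lemma vertex_bijection_exists : exists G, vertex_bijection G.
Proof.
  destruct (classic (exists a b, K a /\ K b /\ a <> b)) as [[a [b [Ka [Kb Nab]]]]|H1].
  - destruct (classic (exists c, K c /\ c <> a /\ c <> b)) as [[c [Kc [Nca Ncb]]]|H2].
    + assert (W : forall z, exists u v, K u /\ K v /\ z <> u /\ u <> v /\ z <> v).
      { intro z. destruct (classic (z = a)) as [->|Na]; [exists b, c; repeat split; auto|].
        destruct (classic (z = b)) as [->|Nb]; [exists a, c; repeat split; auto|].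
        exists a, b; repeat split; auto. }
      assert (W2 : forall y z, exists u, K u /\ y <> u /\ z <> u).
      { intros y z. destruct (W y) as [u [v [Ku [Kv [N1 [N2 N3]]]]]].
        destruct (classic (z = u)) as [->|]; [exists v | exists u]; auto. }
      assert (Tot : forall z, K z -> exists x, vertex_match z x).
      { intros z Kz. destruct (W z) as [u [v [Ku [Kv [N1 [N2 N3]]]]]].
        apply (vertex_match_exists z u v); auto. }
      assert (Mat : forall y z s t, vertex_match y s -> vertex_match z t -> y <> z -> M y z s t).
      { intros y z s t Hs Ht N. destruct (W2 y z) as [u [Ku [N1 N2]]].
        apply (vertex_match_pair y z u); auto. }
      exists vertex_match. split; auto.
      * intros z x [? [? _]]; auto.
      * intros x Lx.
        assert (Q : exists y, L y /\ x <> y).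
        { destruct (pair_match_exists HP HP' HT a b Ka Kb Nab) as [u [v Huv]].
          destruct (classic (x = u)) as [->|]; [exists v | exists u]; split; auto; apply Huv. }
        destruct Q as [y [Ly Nxy]].
        destruct (pair_match_surj x y Lx Ly Nxy) as [d [f Hdf]].
        destruct (Tot d) as [s Hs]; [apply Hdf|]. destruct (Tot f) as [t Ht]; [apply Hdf|].
        assert (Hst : M d f s t) by (apply Mat; auto; apply Hdf).
        destruct (pair_match_unique_r HP' HT _ _ _ _ _ _ Hst Hdf) as [[-> _]|[-> _]]; eauto.
      * intros z x x' Hx Hx'. destruct (W z) as [u [v [Ku [Kv [N1 [N2 N3]]]]]].
        apply (vertex_match_unique z u v); auto.
    + destruct (pair_match_exists HP HP' HT a b Ka Kb Nab) as [u [v H]].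
      assert (D : forall z, K z -> z = a \/ z = b).
      { intros z Kz. apply NNPP; intro Q. apply H2; exists z; tauto. }
      pose proof (match_r _ _ _ _ _ _ _ H) as Nuv.
      assert (D' : forall x, L x -> x = u \/ x = v).
      { intros x Lx. apply NNPP; intro Q.
        destruct (pair_match_surj u x) as [d [f Hdf]]; auto; [apply H|].
        assert (Hab : M a b u x).
        { pose proof (match_l _ _ _ _ _ _ _ Hdf).
          destruct (D d) as [->| ->]; [apply Hdf | |]; destruct (D f) as [->| ->]; try apply Hdf;
            try congruence. apply (pair_match_swap_l HP HT); auto. }
        destruct (pair_match_unique_r HP' HT _ _ _ _ _ _ H Hab) as [[? ?]|[? ?]];
          apply Q; auto. }
      (* With two points on each side the order cannot tell the two bijections apart; either one
         preserves the only pair. *)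
      exists (fun z x => (z = a /\ x = u) \/ (z = b /\ x = v)). split.
      * intros z x [[-> ->]|[-> ->]]; split; apply H.
      * intros z Kz. destruct (D z Kz) as [->| ->]; eauto.
      * intros x Lx. destruct (D' x Lx) as [->| ->]; eauto.
      * intros z x x' [[-> ->]|[-> ->]] [[? ->]|[? ->]]; congruence.
      * intros y z s t [[-> ->]|[-> ->]] [[-> ->]|[-> ->]] N; try congruence; [exact H|].
        apply (pair_match_swap_l HP HT), (pair_match_swap_r HP' HT); auto.
  (* [K] is a single point, and so is [L], since a pair in [L] would match a pair in [K]. *)
  - destruct (family_base L P' HP') as [l Ll].
    exists (fun a x => K a /\ L x). split; auto.
    + intros a Ka; eauto.
    + intros x Lx. destruct (family_base K P HP) as [k Kk]; eauto.
    + intros a x x' [_ Lx] [_ Lx']. apply NNPP; intro N.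
      destruct (pair_match_surj x x' Lx Lx' N) as [d [f Hdf]].
      apply H1; exists d, f. repeat split; apply Hdf.
    + intros a b x y [Ka _] [Kb _] N. exfalso; apply H1; eauto.
Qed.

Lemma vertex_bijection_inj G a b x : vertex_bijection G -> G a x -> G b x -> a = b.
Proof.
  intros HG Ha Hb. apply NNPP; intro N.
  apply (match_r _ _ _ _ _ _ _ (vb_match G HG a b x x Ha Hb N)). reflexivity.
Qed.
End Bijection.

Lemma vertex_bijection_flip {B B' : Space} {K : B -> Prop} {L : B' -> Prop}
  {Th : (B -> B -> Prop) -> (B' -> B' -> Prop) -> Prop} G :
  @vertex_bijection B B' K L Th G ->
  @vertex_bijection B' B L K (fun S' S => Th S S') (fun x a => G a x).
Proof.
  intros HG. split.
  - intros x a H. destruct (vb_dom G HG a x H); auto.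
  - apply (vb_surj G HG).
  - apply (vb_total G HG).
  - intros x a a' H H'. exact (vertex_bijection_inj G a a' x HG H H').
  - intros x y a b Ha Hb N. apply pair_match_flip. apply (vb_match G HG); auto.
    intros ->. apply N. apply (vb_fun G HG b); auto.
Qed.

(** For [a] in [F], a point [b] distinct from [a] lies in [F] exactly when collapsing [F] identifies
    it with [a]. On the other side this describes the class of the partner of [a], and classes are
    closed. Empty [F] offers no such [a] and is handled directly. *)
Lemma vertex_bijection_closed {B B' : Space} {K : B -> Prop} {L : B' -> Prop}
  {P : (B -> B -> Prop) -> Prop} {P' : (B' -> B' -> Prop) -> Prop}
  {Th : (B -> B -> Prop) -> (B' -> B' -> Prop) -> Prop} G (F : B -> Prop) :
  collapse_family K P -> collapse_family L P' -> order_correspondence P P' Th ->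
  @vertex_bijection B B' K L Th G ->
  is_closed F -> (forall a, F a -> K a) ->
  exists F', is_closed F' /\ forall a x, G a x -> (F a <-> F' x).
Proof.
  intros HP HP' HT HG HF FK.
  destruct (classic (exists a, F a)) as [[a Fa]|N].
  - destruct (vb_total G HG a (FK a Fa)) as [x Hx].
    assert (HE : P (collapsed K F)).
    { apply (family_collapsed K P HP); auto. intros p Fp.
      exists (glue K nil). assert (P0 : P (glue K nil)) by (apply (family_glue HP); intros q []).
      split; auto. apply (family_domain K P HP); auto. }
    destruct (corr_total _ _ _ HT _ HE) as [S' HS'].
    pose proof (corr_right _ _ _ HT _ _ HS') as PS'.
    exists (fun y => S' x y). split.
    + apply (family_class_closed L P' HP'); auto. apply (family_domain L P' HP'); auto.
      apply (vb_dom G HG a x Hx).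
    + intros b y Hy. destruct (classic (a = b)) as [<-|Nab].
      * rewrite <- (vb_fun G HG a x y Hx Hy). split; auto. intros _.
        apply (family_domain L P' HP'); auto. apply (vb_dom G HG a x Hx).
      * rewrite <- (match_iff _ _ _ _ _ _ _ (vb_match G HG a b x y Hx Hy Nab) _ _ HS').
        split; [intros Fb; right; auto | intros [[E _]|[_ Fb]]; [contradiction | auto]].
  - exists (fun _ => False). split; [apply closed_empty|]. intros a x _. split; [|tauto].
    intros Fa; eauto.
Qed.

(** * The homeomorphism *)

Lemma vertex_inverse_continuous {B B' : Space} {K : B -> Prop} {L : B' -> Prop}
  {P : (B -> B -> Prop) -> Prop} {P' : (B' -> B' -> Prop) -> Prop}
  {Th : (B -> B -> Prop) -> (B' -> B' -> Prop) -> Prop} G (g : subspace L -> subspace K) :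
  collapse_family K P -> collapse_family L P' -> order_correspondence P P' Th ->
  @vertex_bijection B B' K L Th G -> is_closed K ->
  (forall w, G (proj1_sig (g w)) (proj1_sig w)) -> continuous g.
Proof.
  intros HP HP' HT HG HK Hg V [V' [HV' EV]].
  destruct (vertex_bijection_closed G (fun a => K a /\ ~ V' a) HP HP' HT HG) as [F' [HF' E]].
  - eapply open_ext; [exact (open_or _ _ HK HV')|]. intro a; cbn.
    split; [tauto|]. intros N. destruct (classic (K a)); [right; apply NNPP; tauto | auto].
  - tauto.
  - exists (fun x => ~ F' x). split; [exact HF'|]. intro w.
    rewrite EV, <- (E _ _ (Hg w)). pose proof (proj2_sig (g w)) as Kg. cbn in Kg.
    split; [tauto|]. intro N; apply NNPP; tauto.
Qed.

Lemma order_correspondence_homeomorphic {B B' : Space} {K : B -> Prop} {L : B' -> Prop}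
  {P : (B -> B -> Prop) -> Prop} {P' : (B' -> B' -> Prop) -> Prop}
  {Th : (B -> B -> Prop) -> (B' -> B' -> Prop) -> Prop} :
  collapse_family K P -> collapse_family L P' -> order_correspondence P P' Th ->
  is_closed K -> is_closed L -> homeomorphic (subspace K) (subspace L).
Proof.
  intros HP HP' HT HK HL.
  destruct (vertex_bijection_exists HP HP' HT) as [G HG].
  assert (Hf : forall z : subspace K, exists w : subspace L, G (proj1_sig z) (proj1_sig w)).
  { intros [a Ka]. destruct (vb_total G HG a Ka) as [x Hx].
    exists (exist _ x (proj2 (vb_dom G HG a x Hx))). exact Hx. }
  assert (Hg : forall w : subspace L, exists z : subspace K, G (proj1_sig z) (proj1_sig w)).
  { intros [x Lx]. destruct (vb_surj G HG x Lx) as [a Ha].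
    exists (exist _ a (proj1 (vb_dom G HG a x Ha))). exact Ha. }
  destruct (choice _ Hf) as [f Ff]. destruct (choice _ Hg) as [g Fg].
  exists f, g. split; [|split; [|split]].
  - exact (vertex_inverse_continuous (fun x a => G a x) f HP' HP
             (order_correspondence_flip _ _ _ HT) (vertex_bijection_flip G HG) HL Ff).
  - exact (vertex_inverse_continuous G g HP HP' HT HG HK Fg).
  - intro z. apply eq_sig_hprop; [intros; apply proof_irrelevance|].
    apply (vertex_bijection_inj G _ _ (proj1_sig (f z)) HG); auto.
  - intro w. apply eq_sig_hprop; [intros; apply proof_irrelevance|].
    apply (vb_fun G HG (proj1_sig (g w))); auto.
Qed.

(** * Application to the relations of R(X) *)

Definition remainder_family {X bX : Space} (e : X -> bX) (S : bX -> bX -> Prop) : Prop :=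
  exists A, in_RX A /\ S = remainder_rel e A.

Lemma remainder_family_collapse {X bX : Space} (e : X -> bX) :
  stone_cech X bX e -> locally_realcompact X -> ~ realcompact X ->
  collapse_family (cl_hewitt_remainder e) (remainder_family e).
Proof.
  intros SC HL NR. pose proof (locally_realcompact_remainder e SC HL) as KX. split.
  - apply (stone_cech_hausdorff SC).
  - apply cl_hewitt_remainder_nonempty; auto.
  - intros S p q [A [_ ->]]. apply remainder_rel_sym.
  - intros S p q r [A [_ ->]]. apply (remainder_rel_trans SC).
  - intros S p [A [HA ->]]. apply (cl_hewitt_remainder_domain SC); auto.
  - intros S p [A [_ ->]]. apply (remainder_rel_class_closed SC).
  - intros F HF Hd.
    assert (FX : forall p, F p -> ~ image e p).
    { intros p Fp. destruct (Hd p Fp) as [S [[A [_ ->]] [Np _]]]. exact Np. }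
    exists (collapse_ext SC F HF FX). split; [apply collapse_ext_in_RX; auto|].
    apply functional_extensionality; intro p. apply functional_extensionality; intro q.
    apply propositional_extensionality. symmetry. apply collapse_remainder_rel; auto.
Qed.

Lemma ext_equiv_remainder_rel {X bX : Space} (e : X -> bX) (A B : Ext X) :
  ext_equiv A B -> remainder_rel e A = remainder_rel e B.
Proof.
  intros [f [g [Cf [Cg [gf [fg E]]]]]].
  apply functional_extensionality; intro p. apply functional_extensionality; intro q.
  apply propositional_extensionality. split; apply ext_le_remainder_rel.
  - exists f; auto.
  - exists g; split; auto. intro x. rewrite <- E; auto.
Qed.

Lemma remainder_family_correspondence {X Y bX bY : Space} (eX : X -> bX) (eY : Y -> bY)
  (Phi : Ext X -> Ext Y) :
  stone_cech X bX eX -> stone_cech Y bY eY ->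
  (forall A, in_RX A -> in_RX (Phi A)) ->
  (forall B, in_RX B -> exists A, in_RX A /\ ext_equiv (Phi A) B) ->
  (forall A A', in_RX A -> in_RX A' -> (ext_le A A' <-> ext_le (Phi A) (Phi A'))) ->
  order_correspondence (remainder_family eX) (remainder_family eY)
    (fun S S' => exists A, in_RX A /\ S = remainder_rel eX A /\ S' = remainder_rel eY (Phi A)).
Proof.
  intros SX SY Hin Hsurj Hle. split.
  - intros S S' [A [HA [-> _]]]. exists A; auto.
  - intros S S' [A [HA [_ ->]]]. exists (Phi A); auto.
  - intros S [A [HA ->]]. exists (remainder_rel eY (Phi A)), A; auto.
  - intros S' [B [HB ->]]. destruct (Hsurj B HB) as [A [HA E]].
    exists (remainder_rel eX A), A. split; [exact HA|]. split; [reflexivity|].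
    symmetry. exact (ext_equiv_remainder_rel eY _ _ E).
  - intros S S' T T' [A [HA [-> ->]]] [A' [HA' [-> ->]]]. split; intros H.
    + intros p q. apply ext_le_remainder_rel, Hle; auto.
      apply (remainder_rel_ext_le SX); auto.
    + intros p q. apply ext_le_remainder_rel, Hle; auto.
      apply (remainder_rel_ext_le SY); auto.
Qed.

Theorem theorem3p9 :
  forall (X Y : Space),
    tychonoff X -> tychonoff Y ->
    locally_realcompact X -> locally_realcompact Y ->
    ~ realcompact X -> ~ realcompact Y ->
    forall (bX : Space) (eX : X -> bX) (bY : Space) (eY : Y -> bY),
      stone_cech X bX eX -> stone_cech Y bY eY ->
      RX_order_isomorphic X Y ->
      homeomorphic (subspace (cl_hewitt_remainder eX))
                   (subspace (cl_hewitt_remainder eY)).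
Proof.
  intros X Y _ _ LX LY NX NY bX eX bY eY SX SY [Phi [Hin [_ [_ [Hsurj Hle]]]]].
  eapply order_correspondence_homeomorphic.
  - apply remainder_family_collapse; auto.
  - apply remainder_family_collapse; auto.
  - apply (remainder_family_correspondence eX eY Phi); auto.
  - apply closed_closure.
  - apply closed_closure.
Qed.
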